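(* Let $R$ be a Cohen-Macaulay local ring and let $M$ and $N$ be finitely generated $R$-modules such that $M=\Omega_R L$ for some nonfree maximal Cohen-Macaulay $R$-module $L$. Then the following conditions are equivalent: (i) $N=0$. (ii) $\operatorname{pd}_R(M\otimes_R N)<\infty$. (iii) $\operatorname{id}_R(M\otimes_R N)<\infty$.
   Context: Rings are commutative Noetherian and modules are finitely generated. $\operatorname{pd}_R$ and $\operatorname{id}_R$ denote projective and injective dimension; the zero module is regarded as having finite projective and injective dimension ($-\infty$). For a module $L$ over a local ring $R$, $\Omega_R L$ denotes the first syzygy of $L$ in its minimal free resolution, i.e. the kernel of a surjection $R^{\oplus \mu_R(L)}\to L$, where $\mu_R(L)$ is the minimal number of generators of $L$. An $R$-module $L$ is maximal Cohen-Macaulay if $\operatorname{depth}_R(L)=\dim(R)$. *)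

(* Defs.v *)
From HB Require Import structures.
From mathcomp Require Import all_boot all_algebra generic_quotient.
From mathcomp Require Import boolp classical_sets.

Set Implicit Arguments.
Unset Strict Implicit.
Unset Printing Implicit Defensive.

Import GRing.Theory.
Local Open Scope ring_scope.
Local Open Scope classical_set_scope.
Local Open Scope quotient_scope.

(** * Ideals, Noetherian local rings, Krull dimension *)

Section Rings.
Variable R : comNzRingType.

Definition is_ideal (I : set R) : Prop :=
  [/\ I 0, (forall x y, I x -> I y -> I (x + y))
    & (forall a x, I x -> I (a * x))].

Definition noetherian_ring : Prop :=
  forall I : set R, is_ideal I ->
  exists (n : nat) (g : 'I_n -> R),
    I = [set x | exists a : 'I_n -> R, x = \sum_(i < n) a i * g i].

Definition prime_ideal (P : set R) : Prop :=
  [/\ is_ideal P, ~ P 1 & forall x y, P (x * y) -> P x \/ P y].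

Definition maximal_ideal (m : set R) : Prop :=
  [/\ is_ideal m, ~ m 1
    & forall J : set R, is_ideal J -> m `<=` J -> ~ J 1 -> J = m].

(* [m] is the unique maximal ideal of [R] *)
Definition local_ring (m : set R) : Prop :=
  maximal_ideal m /\ forall m' : set R, maximal_ideal m' -> m' = m.

(* p 0 ⊊ p 1 ⊊ ... ⊊ p n; the values of [p] beyond [n] are irrelevant *)
Definition prime_chain (n : nat) (p : nat -> set R) : Prop :=
  (forall i, (i <= n)%N -> prime_ideal (p i)) /\
  (forall i, (i < n)%N -> p i `<` p i.+1).

Definition krull_dim_is (d : nat) : Prop :=
  (exists p, prime_chain d p) /\ (forall n p, prime_chain n p -> (n <= d)%N).

End Rings.

(** * Finitely generated modules, depth, Cohen-Macaulay modules *)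

Section Modules.
Variables (R : comNzRingType) (m : set R).
Implicit Types (L M : lmodType R).

Definition generated_by M (n : nat) : Prop :=
  exists g : 'I_n -> M,
    forall x : M, exists a : 'I_n -> R, x = \sum_(i < n) a i *: g i.

Definition fingen M : Prop := exists n, generated_by M n.

(* the minimal number of generators of [M] is [n] *)
Definition mu_is M (n : nat) : Prop :=
  generated_by M n /\ forall k, generated_by M k -> (n <= k)%N.

Definition lin_indep M (B : set M) : Prop :=
  forall (s : seq M) (a : M -> R), uniq s -> [set` s] `<=` B ->
    \sum_(b <- s) a b *: b = 0 -> forall b, b \in s -> a b = 0.

Definition spanning M (B : set M) : Prop :=
  forall x : M, exists (s : seq M) (a : M -> R),
    [set` s] `<=` B /\ x = \sum_(b <- s) a b *: b.

Definition free_module M : Prop :=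
  exists B : set M, lin_indep B /\ spanning B.

(* the submodule (s_0, ..., s_{k-1}) M *)
Definition seq_smul (s : seq R) M : set M :=
  [set v | exists w : 'I_(size s) -> M, v = \sum_(i < size s) s`_i *: w i].

(* s_i is a nonzerodivisor on M / (s_0, ..., s_{i-1}) M, and M / (s) M != 0 *)
Definition regular_seq M (s : seq R) : Prop :=
  (forall (i : nat) (v : M), (i < size s)%N ->
     seq_smul (take i s) (s`_i *: v) -> seq_smul (take i s) v) /\
  @seq_smul s M <> setT.

(* The supremum of the lengths of the [M]-regular sequences in the maximal
   ideal [m] is attained and equal to [d].  The zero module has no regular
   sequence at all, so it has no depth in this sense; this agrees with the
   convention depth 0 = oo. *)
Definition depth_is M (d : nat) : Prop :=
  (exists s, [/\ size s = d, [set` s] `<=` m & regular_seq M s]) /\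
  (forall s, [set` s] `<=` m -> regular_seq M s -> (size s <= d)%N).

Definition maximal_cohen_macaulay M : Prop :=
  exists d, depth_is M d /\ krull_dim_is R d.

Definition cohen_macaulay_ring : Prop := maximal_cohen_macaulay R^o.

(* [M] is (isomorphic to) the kernel of a surjection R^(mu(L)) -> L *)
Definition is_first_syzygy M L : Prop :=
  exists (n : nat) (p : {linear 'rV[R]_n -> L}) (i : {linear M -> 'rV[R]_n}),
    [/\ mu_is L n, (forall y, exists x, p x = y), injective i
      & forall x, p x = 0 <-> exists z, i z = x].

End Modules.

(** * Projective and injective dimension *)

Section HomologicalDimension.
Variable R : comNzRingType.
Implicit Types (X P E : lmodType R).

Definition projective P : Prop :=
  forall (A B : lmodType R) (q : {linear A -> B}) (g : {linear P -> B}),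
    (forall b, exists a, q a = b) ->
    exists h : {linear P -> A}, forall x, q (h x) = g x.

Definition injective_module E : Prop :=
  forall (A B : lmodType R) (j : {linear A -> B}) (g : {linear A -> E}),
    injective j -> exists h : {linear B -> E}, forall x, h (j x) = g x.

(* an exact sequence 0 -> P_n -> ... -> P_0 -> X -> 0, padded by zeros,
   with all P_i projective *)
Definition projective_resolution X (n : nat) : Prop :=
  exists (P : nat -> lmodType R) (d : forall i, {linear P i.+1 -> P i})
         (e : {linear P 0 -> X}),
    [/\ (forall i, projective (P i)),
        (forall i (x : P i), (n < i)%N -> x = 0),
        (forall y, exists x, e x = y),
        (forall x, e x = 0 <-> exists z, d 0 z = x)
      & (forall i x, d i x = 0 <-> exists z, d i.+1 z = x)].

(* an exact sequence 0 -> X -> E^0 -> ... -> E^n -> 0, padded by zeros,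
   with all E^i injective *)
Definition injective_resolution X (n : nat) : Prop :=
  exists (E : nat -> lmodType R) (d : forall i, {linear E i -> E i.+1})
         (e : {linear X -> E 0}),
    [/\ (forall i, injective_module (E i)),
        (forall i (x : E i), (n < i)%N -> x = 0),
        injective e,
        (forall x, d 0 x = 0 <-> exists z, e z = x)
      & (forall i x, d i.+1 x = 0 <-> exists z, d i z = x)].

Definition pd_finite X : Prop := exists n, projective_resolution X n.
Definition id_finite X : Prop := exists n, injective_resolution X n.

End HomologicalDimension.

(** * Tensor product of modules

   An element is represented by a formal sum of pairs (x, y), standing for
   the sum of the x ⊗ y.  Two formal sums are identified when no bilinear
   map separates them; lemmas [tensor_lift] and [tensor_hom_ext] below are
   the universal property. *)

Section Tensor.
Variables (R : comNzRingType) (M N : lmodType R).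

Definition formal_eval (W : lmodType R) (f : M -> N -> W) (s : seq (M * N)) :=
  \sum_(u <- s) f u.1 u.2.

Definition tensor_rel (s t : seq (M * N)) : bool :=
  `[< forall (W : lmodType R) (f : {bilinear M -> N -> W}),
        formal_eval f s = formal_eval f t >].

Lemma tensor_rel_refl : reflexive tensor_rel.
Proof. by move=> s; apply/asboolP. Qed.

Lemma tensor_rel_sym : symmetric tensor_rel.
Proof. by move=> s t; apply/asboolP/asboolP => h W f; rewrite h. Qed.

Lemma tensor_rel_trans : transitive tensor_rel.
Proof.
move=> t s u /asboolP h1 /asboolP h2; apply/asboolP => W f.
by rewrite h1 h2.
Qed.

Canonical tensor_equiv :=
  EquivRel tensor_rel tensor_rel_refl tensor_rel_sym tensor_rel_trans.

Definition tensor := {eq_quot tensor_rel}.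
HB.instance Definition _ := Choice.on tensor.
HB.instance Definition _ := EqQuotient.on tensor.

Definition scale_formal (a : R) (s : seq (M * N)) : seq (M * N) :=
  [seq (a *: u.1, u.2) | u <- s].

Definition tensor_of (s : seq (M * N)) : tensor := \pi_tensor s.
Definition tensor_add (u v : tensor) : tensor := tensor_of (repr u ++ repr v).
Definition tensor_scale (a : R) (u : tensor) : tensor :=
  tensor_of (scale_formal a (repr u)).
Definition tensor_zero : tensor := tensor_of [::].
Definition tensor_opp (u : tensor) : tensor := tensor_scale (-1) u.

Definition tensor_eval (W : lmodType R) (f : M -> N -> W) (u : tensor) : W :=
  formal_eval f (repr u).

Lemma formal_eval_cat (W : lmodType R) (f : M -> N -> W) s t :
  formal_eval f (s ++ t) = formal_eval f s + formal_eval f t.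
Proof. by rewrite /formal_eval big_cat. Qed.

Lemma formal_eval_scale (W : lmodType R) (f : {bilinear M -> N -> W}) a s :
  formal_eval f (scale_formal a s) = a *: formal_eval f s.
Proof.
rewrite /formal_eval big_map scaler_sumr.
by apply: eq_bigr => u _ /=; rewrite linearZl.
Qed.

Lemma tensor_eval_of (W : lmodType R) (f : {bilinear M -> N -> W}) s :
  tensor_eval f (tensor_of s) = formal_eval f s.
Proof.
have /eqmodP/asboolP : repr (tensor_of s) = s %[mod tensor] by rewrite reprK.
exact.
Qed.

Lemma tensor_ext (u v : tensor) :
  (forall (W : lmodType R) (f : {bilinear M -> N -> W}),
     tensor_eval f u = tensor_eval f v) -> u = v.
Proof.
by move=> h; rewrite -(reprK u) -(reprK v); apply/eqmodP/asboolP.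
Qed.

Lemma tensor_evalD (W : lmodType R) (f : {bilinear M -> N -> W}) u v :
  tensor_eval f (tensor_add u v) = tensor_eval f u + tensor_eval f v.
Proof. by rewrite tensor_eval_of formal_eval_cat. Qed.

Lemma tensor_evalZ (W : lmodType R) (f : {bilinear M -> N -> W}) a u :
  tensor_eval f (tensor_scale a u) = a *: tensor_eval f u.
Proof. by rewrite tensor_eval_of formal_eval_scale. Qed.

Lemma tensor_eval0 (W : lmodType R) (f : {bilinear M -> N -> W}) :
  tensor_eval f tensor_zero = 0.
Proof. by rewrite tensor_eval_of /formal_eval big_nil. Qed.

Definition tensor_evalE := (tensor_evalD, tensor_evalZ, tensor_eval0).

Lemma tensor_addA : associative tensor_add.
Proof. by move=> u v w; apply: tensor_ext => W f; rewrite !tensor_evalE addrA. Qed.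
Lemma tensor_addC : commutative tensor_add.
Proof. by move=> u v; apply: tensor_ext => W f; rewrite !tensor_evalE addrC. Qed.
Lemma tensor_add0 : left_id tensor_zero tensor_add.
Proof. by move=> u; apply: tensor_ext => W f; rewrite !tensor_evalE add0r. Qed.
Lemma tensor_addN : left_inverse tensor_zero tensor_opp tensor_add.
Proof.
by move=> u; apply: tensor_ext => W f; rewrite !tensor_evalE scaleN1r addNr.
Qed.
Lemma tensor_scaleA a b u :
  tensor_scale a (tensor_scale b u) = tensor_scale (a * b) u.
Proof. by apply: tensor_ext => W f; rewrite !tensor_evalE scalerA. Qed.
Lemma tensor_scale1 : left_id 1 tensor_scale.
Proof. by move=> u; apply: tensor_ext => W f; rewrite !tensor_evalE scale1r. Qed.
Lemma tensor_scaleDr : right_distributive tensor_scale tensor_add.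
Proof.
by move=> a u v; apply: tensor_ext => W f; rewrite !tensor_evalE scalerDr.
Qed.
Lemma tensor_scaleDl u :
  {morph tensor_scale^~ u : a b / a + b >-> tensor_add a b}.
Proof. by move=> a b; apply: tensor_ext => W f; rewrite !tensor_evalE scalerDl. Qed.

HB.instance Definition _ := GRing.isZmodule.Build tensor
  tensor_addA tensor_addC tensor_add0 tensor_addN.
HB.instance Definition _ := GRing.Zmodule_isLmodule.Build R tensor
  tensor_scaleA tensor_scale1 tensor_scaleDr tensor_scaleDl.

Definition tens (x : M) (y : N) : tensor := tensor_of [:: (x, y)].

Lemma tensor_eval_tens (W : lmodType R) (f : {bilinear M -> N -> W}) x y :
  tensor_eval f (tens x y) = f x y.
Proof. by rewrite tensor_eval_of /formal_eval big_seq1. Qed.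

Lemma tens_bilinear : bilinear_for *:%R *:%R tens.
Proof.
split=> [y a x x' | x a y y']; apply: tensor_ext => W f;
  rewrite tensor_evalD tensor_evalZ !tensor_eval_tens.
- by rewrite linearPl.
- by rewrite linearPr.
Qed.

HB.instance Definition _ :=
  bilinear_isBilinear.Build R M N tensor *:%R *:%R tens tens_bilinear.

Lemma tensor_eval_linear (W : lmodType R) (f : {bilinear M -> N -> W}) :
  linear (tensor_eval f).
Proof. by move=> a u v; rewrite tensor_evalD tensor_evalZ. Qed.

Lemma tensor_lift (W : lmodType R) (f : {bilinear M -> N -> W}) :
  exists h : {linear tensor -> W}, forall x y, h (tens x y) = f x y.
Proof.
pose h := GRing.isLinear.Build R tensor W *:%R _ (tensor_eval_linear f).
pose H : {linear tensor -> W} := HB.pack (tensor_eval f) h.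
by exists H => x y; exact: tensor_eval_tens.
Qed.

Lemma tensor_sum_tens (u : tensor) :
  exists s : seq (M * N), u = \sum_(p <- s) tens p.1 p.2.
Proof.
exists (repr u); rewrite -[LHS]reprK; elim: (repr u) => [|[x y] s ih].
  by rewrite big_nil.
rewrite big_cons -ih; apply: tensor_ext => W f.
rewrite tensor_evalD tensor_eval_tens !tensor_eval_of.
by rewrite /formal_eval big_cons.
Qed.

Lemma tensor_hom_ext (W : lmodType R) (h k : {linear tensor -> W}) :
  (forall x y, h (tens x y) = k (tens x y)) -> h =1 k.
Proof.
move=> hk u; have [s ->] := tensor_sum_tens u.
by rewrite !linear_sum; apply: eq_bigr => p _; exact: hk.
Qed.

End Tensor.

(* Main.v *)
Require Import Defs.
From HB Require Import structures.
From mathcomp Require Import all_boot all_order all_algebra.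
From mathcomp Require Import boolp classical_sets.
From mathcomp Require Import freeg.

(** Let [F -> L] be the minimal free cover with kernel [M], so that [M] lies in
    [m F], and let [X] be the tensor product of [M] and [N].  If [N] is nonzero,
    some tensor [x (x) y] is nonzero modulo [m X], because [M] is nonzero too
    ([L] is not free) and the residue fields of [M] and [N] have a nonzero
    tensor product ([residue_functional_tensor]).  That tensor is a value of the
    map [f : M -> X] sending [x] to [x (x) y].  A map that extends to [F] takes
    [M] into [m X], so [f] does not extend, and [Ext^1(L, X)] contains the
    obstruction.  The proof shows that finite projective or injective dimension
    forces the obstruction to vanish after a change of target that still detects
    [X / m X].

    Since [R] and [L] have the same depth [d = dim R], there is a sequence [s]
    of length [d] in [m] that is regular on both ([common_regular_seq], by
    prime avoidance and the invariance of the depth, [socle_after_regular]).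
    The ring [R / (s)] has dimension zero, so every nonzero module over it has
    a socle ([parameters_has_socle]); let [c] represent a socle element of it.
    As [s] is regular on [L] and on [F], the map [M / s M -> F / s F] is
    injective ([regular_seq_kernel]), and likewise for the higher syzygies of
    [L]: a map from [M] to a module injective over [R / (s)] extends to [F].

    Finite projective dimension.  The module [W] of the additive maps from
    [R / (s)] to [Q / Z] is injective over [R / (s)] and has an element [w] with
    [c w] nonzero.  If [P] is projective, maps from syzygies of [L] into
    [P (x) W] extend, and dimension shifting along a projective resolution of
    [X] shows that [f (x) w : M -> X (x) W] extends to [F]
    ([pd_le_tensor_extend]).  Hence it takes values in [m (X (x) W)], which is
    killed by the map sending [x (x) w] to [h x] times [c w], where [h] reads
    off a coordinate in [X / m X].

    Finite injective dimension.  Let [E] be a finite injective resolution of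
    [X].  The complex [Hom(R / (s), E)] is exact above degree [d]
    ([killed_exact]), since [s] is regular on [R].  Its modules are injective
    over [R / (s)], and so are its cycles in degree [d] and above, by descending
    induction and because socle elements of cycles lift
    ([cycles_injective_ge]).  Solving one equation [v (a z) = f z] for each
    entry [a] of [s] turns [f] into a map from [M] to the cycles of degree [d],
    which extends to [F]; going back down yields a map [F -> X] that agrees
    with [f] on [M] modulo [m X] ([extend_modulo]). *)

Set Implicit Arguments.
Unset Strict Implicit.
Unset Printing Implicit Defensive.

Import Order.TTheory GRing.Theory Num.Theory.
Local Open Scope ring_scope.
Local Open Scope classical_set_scope.

(** * Submodules and Noetherian modules *)

Section Submodules.
Variables (R : comNzRingType).

Definition submodule (V : lmodType R) (S : set V) : Prop :=
  S 0 /\ forall a x y, S x -> S y -> S (a *: x + y).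

Section Closure.
Variables (V : lmodType R) (S : set V) (sS : submodule S).

Lemma submoduleD x y : S x -> S y -> S (x + y).
Proof. by move=> Sx Sy; rewrite -[x]scale1r; apply: sS.2. Qed.

Lemma submoduleZ a x : S x -> S (a *: x).
Proof. by move=> Sx; rewrite -[_ *: _]addr0; apply: sS.2 => //; exact: sS.1. Qed.

Lemma submoduleN x : S x -> S (- x).
Proof. by rewrite -scaleN1r; exact: submoduleZ. Qed.

Lemma submoduleB x y : S x -> S y -> S (x - y).
Proof. by move=> Sx /submoduleN; exact: submoduleD. Qed.

Lemma submodule_addl x y : S x -> S (x + y) -> S y.
Proof. by move=> Sx Sxy; rewrite -[y](addKr x) addrC; apply: submoduleB. Qed.

Lemma submodule_sum I (r : seq I) (P : pred I) F :
  (forall i, P i -> S (F i)) -> S (\sum_(i <- r | P i) F i).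
Proof. by move=> SF; apply: big_ind => //; [exact: sS.1 | exact: submoduleD]. Qed.

End Closure.

Lemma submodule0 (V : lmodType R) : submodule ([set 0] : set V).
Proof. by split=> // a x y -> ->; rewrite scaler0 addr0. Qed.

Lemma submoduleT (V : lmodType R) : submodule ([set: V]).
Proof. by []. Qed.

Lemma submoduleI (V : lmodType R) (S T : set V) :
  submodule S -> submodule T -> submodule (S `&` T).
Proof.
move=> sS sT; split; first by split; [exact: sS.1 | exact: sT.1].
by move=> a x y [Sx Tx] [Sy Ty]; split; [exact: sS.2 | exact: sT.2].
Qed.

Lemma ideal_submodule (I : set R) : is_ideal I <-> @submodule R^o I.
Proof.
split=> [[I0 ID IM] | [I0 IL]].
  by split=> // a x y Ix Iy; apply: ID => //; exact: IM.
have sI : @submodule R^o I by [].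
by split=> // [x y | a x]; [exact: (submoduleD sI) | exact: (submoduleZ sI)].
Qed.

Fixpoint lspan (V : lmodType R) (gs : seq V) : set V :=
  if gs is g :: gs' then [set x | exists a y, lspan gs' y /\ x = a *: g + y]
  else [set 0].

Lemma lspan_submodule (V : lmodType R) (gs : seq V) : submodule (lspan gs).
Proof.
elim: gs => [|g gs ih]; first exact: submodule0.
split; first by exists 0, 0; rewrite scale0r addr0; split=> //; exact: ih.1.
move=> c _ _ [a [x [Sx ->]]] [b [y [Sy ->]]].
exists (c * a + b), (c *: x + y); split; first exact: ih.2.
by rewrite scalerDr scalerA scalerDl addrACA.
Qed.

Lemma lspan_sub (V : lmodType R) (S : set V) gs : submodule S ->
  (forall g, g \in gs -> S g) -> lspan gs `<=` S.
Proof.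
move=> sS; elim: gs => [_ x -> | g gs ih gsS x [a [y [gsy ->]]]]; first exact: sS.1.
apply: sS.2; first by apply: gsS; rewrite mem_head.
by apply: ih gsy => h hgs; apply: gsS; rewrite inE hgs orbT.
Qed.

Lemma mem_lspan (V : lmodType R) (gs : seq V) g : g \in gs -> lspan gs g.
Proof.
elim: gs => // h gs ih; rewrite inE => /orP[/eqP -> | /ih ggs].
  by exists 1, 0; rewrite scale1r addr0; split=> //; exact: (lspan_submodule gs).1.
by exists 0, g; rewrite scale0r add0r.
Qed.

Lemma lspanS (V : lmodType R) (gs hs : seq V) :
  {subset gs <= hs} -> lspan gs `<=` lspan hs.
Proof.
by move=> gh; apply: lspan_sub (lspan_submodule hs) _ => g /gh; exact: mem_lspan.
Qed.

Lemma lspan_sumP (V : lmodType R) (gs : seq V) x :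
  lspan gs x -> exists a : 'I_(size gs) -> R, x = \sum_i a i *: gs`_i.
Proof.
elim: gs x => [x -> | g gs ih x [a [y [/ih[b ->] ->]]]].
  by exists (fun=> 0); rewrite big_ord0.
exists (fun i => if unlift ord0 i is Some j then b j else a).
rewrite big_ord_recl unlift_none; congr (_ + _).
by apply: eq_bigr => i _; rewrite liftK.
Qed.

Lemma generated_byP (V : lmodType R) n :
  generated_by V n <-> exists gs : seq V, size gs = n /\ lspan gs = setT.
Proof.
split=> [[g gT] | [gs [<- gsT]]].
  exists (codom g); rewrite size_codom card_ord; split=> //.
  apply/seteqP; split=> // x _; have [a ->] := gT x.
  apply: (submodule_sum (lspan_submodule _)) => i _.
  apply: (submoduleZ (lspan_submodule _)); apply: mem_lspan; exact: codom_f.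
exists (fun i => gs`_i) => x.
by have /lspan_sumP : lspan gs x by rewrite gsT.
Qed.

Lemma fingenP (V : lmodType R) :
  fingen V <-> exists gs : seq V, lspan gs = setT.
Proof.
split=> [[n /generated_byP[gs [_ gsT]]] | [gs gsT]]; first by exists gs.
by exists (size gs); apply/generated_byP; exists gs.
Qed.

Definition noetherian_module (V : lmodType R) : Prop :=
  forall S : set V, submodule S -> exists gs, S = lspan gs.

Hypothesis R_noeth : noetherian_ring R.

(** The leading coefficients of the elements of [S] along [g] form an ideal,
    hence finitely many of them, together with generators of the part of [S]
    that does not involve [g], generate [S]. *)
Lemma submodule_span_fg (V : lmodType R) (gs : seq V) (S : set V) :
  submodule S -> S `<=` lspan gs -> exists hs, S = lspan hs.
Proof.
elim: gs S => [|g gs ih] S sS Sgs.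
  exists [::]; apply/seteqP; split=> // x ->; exact: sS.1.
pose I : set R := [set a | exists y, lspan gs y /\ S (a *: g + y)].
have iI : is_ideal I.
  apply/ideal_submodule; split.
    by exists 0; rewrite scale0r addr0; split; [exact: (lspan_submodule _).1 | exact: sS.1].
  move=> c a b [x [gx Sx]] [y [gy Sy]]; exists (c *: x + y); split.
    exact: (lspan_submodule gs).2.
  by have := sS.2 c _ _ Sx Sy; rewrite scalerDr scalerA addrACA -scalerDl.
have [n [a Ia]] := R_noeth iI.
have /choice[y yP] (i : 'I_n) : exists y, lspan gs y /\ S (a i *: g + y).
  suff : I (a i) by [].
  rewrite Ia; exists (fun j => (j == i)%:R).
  rewrite (bigD1 i) //= eqxx mul1r big1 ?addr0 // => j /negPf ->.
  by rewrite mul0r.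
have [hs hsE] := ih (S `&` lspan gs) (submoduleI sS (lspan_submodule gs))
  (fun x => @proj2 _ _).
have hsS x : lspan hs x -> S x by rewrite -hsE => -[].
exists (codom (fun i => a i *: g + y i) ++ hs); apply/seteqP; split; last first.
  apply: lspan_sub => // h; rewrite mem_cat => /orP[/codomP[i ->] | /mem_lspan/hsS //].
  by have [] := yP i.
move=> x Sx; have [c [z [gz xE]]] := Sgs x Sx.
have : I c by exists z; rewrite -xE.
rewrite Ia => -[b cE].
set T := lspan _; have sT : submodule T by exact: lspan_submodule.
have ->: x = \sum_i b i *: (a i *: g + y i) + (z - \sum_i b i *: y i).
  rewrite xE cE scaler_suml addrC [in RHS]addrC -addrA; congr (_ + _).
  rewrite -sumrN -big_split /=; apply: eq_bigr => i _.
  by rewrite scalerDr scalerA addrC addrK.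
apply: (submoduleD sT).
  apply: (submodule_sum sT) => i _; apply: (submoduleZ sT); apply: mem_lspan.
  by rewrite mem_cat codom_f.
apply: (@lspanS _ hs) => [h hhs|]; first by rewrite mem_cat hhs orbT.
rewrite -hsE; split; last first.
  apply: (submoduleB (lspan_submodule gs)) => //.
  apply: (submodule_sum (lspan_submodule gs)) => i _.
  by apply: (submoduleZ (lspan_submodule gs)); have [] := yP i.
have -> : z - \sum_i b i *: y i = x - \sum_i b i *: (a i *: g + y i).
  rewrite xE cE scaler_suml -addrA addrCA; congr (_ + _).
  rewrite -!sumrN -big_split /=; apply: eq_bigr => i _.
  by rewrite scalerDr scalerA opprD addrA subrr add0r.
apply: (submoduleB sS) => //; apply: (submodule_sum sS) => i _.
by apply: (submoduleZ sS); have [] := yP i.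
Qed.

Lemma fingen_noetherian (V : lmodType R) : fingen V -> noetherian_module V.
Proof. by move=> /fingenP[gs gsT] S sS; apply: (@submodule_span_fg _ gs) => //; rewrite gsT. Qed.

(** Zorn's lemma applies because a chain whose union is finitely generated
    contains its union. *)
Lemma maximal_submodule (V : lmodType R) (F : set (set V)) (S0 : set V) :
  noetherian_module V -> (forall S, F S -> submodule S) -> F S0 ->
  exists S, [/\ F S, S0 `<=` S & forall T, F T -> S `<=` T -> T = S].
Proof.
move=> Vn Fsub FS0.
(* the union of the empty chain is empty, hence the first alternative *)
pose P (A : set V) := A = set0 \/ (F A /\ S0 `<=` A).
have [|A [PA maxA]] := @Zorn_bigcup V P.
  move=> C CP totC.
  have [[B [CB FB B0]] | noB] :=
      pselect (exists B, [/\ C B, F B & S0 `<=` B]); last first.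
    left; apply/seteqP; split=> // x [B CB Bx].
    have [B0 | [FB SB]] := CP B CB; first by rewrite B0 in Bx.
    by case: noB; exists B.
  right; set U := \bigcup_(X in C) X.
  have sU : submodule U.
    split; first by exists B => //; exact: (Fsub B FB).1.
    move=> a x y [X CX Xx] [Y CY Yy].
    have sub Z z : C Z -> Z z -> submodule Z.
      by move=> CZ Zz; have [Z0 | [/Fsub //]] := CP Z CZ; rewrite Z0 in Zz.
    have [XY | YX] := totC X Y CX CY.
      by exists Y => //; apply: (sub Y y CY Yy).2 => //; exact: XY.
    by exists X => //; apply: (sub X x CX Xx).2 => //; exact: YX.
  have [gs UE] := Vn U sU.
  have [X [CX FX SX gsX]] :
      exists X, [/\ C X, F X, S0 `<=` X & forall g, g \in gs -> X g].
    have : forall g, g \in gs -> U g by move=> g /mem_lspan; rewrite -UE.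
    elim: (gs) => [_ | g gs' ih gU]; first by exists B.
    have [h hgs|X [CX FX SX gX]] := ih; first by apply: gU; rewrite inE hgs orbT.
    have [Y CY Yg] := gU g (mem_head _ _).
    have [YX | XY] := totC Y X CY CX.
      exists X; split=> // h; rewrite inE => /orP[/eqP ->|/gX //]; exact: YX.
    exists Y; split=> //.
    - by have [Y0|[]//] := CP Y CY; rewrite Y0 in Yg.
    - by move=> x /SX; exact: XY.
    - by move=> h; rewrite inE => /orP[/eqP -> //|/gX]; exact: XY.
  suff -> : U = X by [].
  apply/seteqP; split=> [|x Xx]; last by exists X.
  by rewrite UE; apply: lspan_sub => //; exact: Fsub.
have [A0 | [FA SA]] := PA.
  case: (maxA S0); last by right; split.
  rewrite A0; split; first exact: sub0set.
  by move=> /(_ 0 (Fsub _ FS0).1).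
exists A; split=> // T FT AT.
apply: contrapT => neq; apply: (maxA T); last by right; split=> // x /SA; exact: AT.
split=> // TA; apply: neq; exact/seteqP.
Qed.

End Submodules.

(** * Depth and regular sequences modulo a submodule *)

Section RegularSequences.
Variables (R : comNzRingType).
Implicit Types V : lmodType R.

Definition add_mul V (U : set V) (a : R) : set V :=
  [set v | exists u w, U u /\ v = u + a *: w].

Definition add_muls V (U : set V) (s : seq R) : set V := foldl (@add_mul V) U s.

Definition regular_mod V (U : set V) (a : R) : Prop :=
  forall v, U (a *: v) -> U v.

Fixpoint regular_seq_mod V (U : set V) (s : seq R) : Prop :=
  if s is a :: s' then regular_mod U a /\ regular_seq_mod (add_mul U a) s'
  else True.

Lemma add_mul_submodule V (U : set V) a : submodule U -> submodule (add_mul U a).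
Proof.
move=> sU; split; first by exists 0, 0; rewrite scaler0 addr0; split=> //; exact: sU.1.
move=> c _ _ [u [w [Uu ->]]] [u' [w' [Uu' ->]]].
exists (c *: u + u'), (c *: w + w'); split; first exact: sU.2.
by rewrite !scalerDr !scalerA addrACA mulrC.
Qed.

Lemma add_muls_submodule V (U : set V) s : submodule U -> submodule (add_muls U s).
Proof. by elim: s U => //= a s ih U /(add_mul_submodule a); exact: ih. Qed.

Lemma add_mulS V (U : set V) a : U `<=` add_mul U a.
Proof. by move=> u Uu; exists u, 0; rewrite scaler0 addr0. Qed.

Lemma add_mul_mem V (U : set V) a v : submodule U -> add_mul U a (a *: v).
Proof. by move=> sU; exists 0, v; rewrite add0r; split=> //; exact: sU.1. Qed.

Lemma add_mulC V (U : set V) a b :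
  add_mul (add_mul U a) b = add_mul (add_mul U b) a.
Proof.
apply/seteqP; split=> _ [_ [w [[u [w' [Uu ->]]] ->]]].
  by exists (u + b *: w), w'; split; [exists u, w | rewrite addrAC].
by exists (u + a *: w), w'; split; [exists u, w | rewrite addrAC].
Qed.

Lemma add_muls_rcons V (U : set V) s a :
  add_muls U (rcons s a) = add_mul (add_muls U s) a.
Proof. by rewrite /add_muls foldl_rcons. Qed.

Lemma regular_seq_mod_cat V (U : set V) s t :
  regular_seq_mod U (s ++ t) <->
  regular_seq_mod U s /\ regular_seq_mod (add_muls U s) t.
Proof.
elim: s U => [|a s ih] U /=; first by split=> // -[].
by split=> [[aU /ih[]] | [[aU sU tU]]]; [split | split=> //; exact/ih].
Qed.

Lemma seq_smulE V (s : seq R) : @seq_smul R s V = add_muls [set 0] s.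
Proof.
elim/last_ind: s => [|s a ih].
  apply/seteqP; split=> [_ [w ->] | _ ->] /=; first by rewrite big_ord0.
  by exists (fun=> 0); rewrite big_ord0.
rewrite add_muls_rcons -ih; apply/seteqP; split.
  move=> _ [w ->]; pose g i := if insub i is Some j then w j else 0.
  have -> : \sum_(i < size (rcons s a)) (rcons s a)`_i *: w i = \sum_(i < size (rcons s a)) (rcons s a)`_i *: g i.
    by apply: eq_bigr => i _; rewrite /g valK.
  rewrite size_rcons big_ord_recr /= nth_rcons ltnn eqxx.
  exists (\sum_(i < size s) (rcons s a)`_i *: g i), (g (size s)); split=> //.
  exists (fun i => g i); apply: eq_bigr => i _.
  by rewrite nth_rcons ltn_ord.
move=> _ [_ [w [[w' ->] ->]]].
pose g i := if insub i is Some j then w' j else w.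
exists (fun i => g i).
transitivity (\sum_(i < (size s).+1) (rcons s a)`_i *: g i); last by rewrite size_rcons.
rewrite big_ord_recr /= /g nth_rcons ltnn eqxx insubF ?ltnn //; congr (_ + _).
by apply: eq_bigr => i _; rewrite nth_rcons ltn_ord valK.
Qed.

Lemma regular_seqW V (s : seq R) : regular_seq V s -> regular_seq_mod [set 0 : V] s.
Proof.
case=> + _; elim/last_ind: s => //= s a ih reg.
rewrite -cats1; apply/regular_seq_mod_cat; split.
  apply: ih => i v lti; have := reg i v; rewrite size_rcons => /(_ (ltnW lti)).
  by rewrite -cats1 takel_cat 1?ltnW // nth_cat lti.
split=> // v; have := reg (size s) v; rewrite size_rcons => /(_ (leqnn _)).
by rewrite -cats1 take_size_cat // nth_cat ltnn subnn /= seq_smulE.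
Qed.

End RegularSequences.

(** ** Nakayama's lemma *)

Section Local.
Variables (R : comNzRingType) (m : set R).
Hypotheses (R_noeth : noetherian_ring R) (R_local : local_ring m).
Implicit Types V : lmodType R.

Lemma fingen_regular : fingen R^o.
Proof.
exists 1%N; exists (fun=> 1) => x; exists (fun=> x).
by rewrite big_ord1 /GRing.scale /= mulr1.
Qed.

Lemma maximal_ideal_submodule : @submodule R R^o m.
Proof. by apply/ideal_submodule; case: R_local => [[]]. Qed.

Lemma maximal_ideal_proper : ~ m 1.
Proof. by case: R_local => [[]]. Qed.

Lemma maximal_idealMl a x : m x -> m (a * x).
Proof. exact: (submoduleZ maximal_ideal_submodule). Qed.

Lemma local_unit a : ~ m a -> exists b, b * a = 1.
Proof.
move=> ma; apply: contrapT => noinv; apply: ma.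
pose I : set R := [set x | exists b, b * a = x].
have sI : @submodule R R^o I.
  split; first by exists 0; rewrite mul0r.
  by move=> c _ _ [x <-] [y <-]; exists (c * x + y); rewrite mulrDl -mulrA.
pose F : set (set R^o) := [set J | submodule J /\ ~ J 1].
have [|J [[sJ J1] IJ maxJ]] := @maximal_submodule _ R^o F I (fingen_noetherian R_noeth fingen_regular)
    (fun S => @proj1 _ _); first by [].
suff <- : J = m by apply: IJ; exists 1; rewrite mul1r.
apply: R_local.2; split=> //; first exact/ideal_submodule.
by move=> K /ideal_submodule sK JK K1; exact: maxJ.
Qed.

Lemma local_unit1B a : m a -> exists b, b * (1 - a) = 1.
Proof.
move=> ma; apply: local_unit => m1a; apply: maximal_ideal_proper.
by rewrite -(subrK a 1); exact: (submoduleD maximal_ideal_submodule).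
Qed.

(** A maximal proper submodule [Y] of [K] above [U] has the residue field as
    quotient [K / Y]; this is Nakayama's lemma for [K / U]. *)
Lemma nakayama_maximal V (U K : set V) :
  noetherian_module V -> submodule U -> submodule K -> U `<=` K ->
  ~ K `<=` U ->
  exists (Y : set V) (x0 : V), [/\ submodule Y, U `<=` Y, K x0 /\ ~ Y x0,
    (forall x, K x -> exists r, Y (x - r *: x0))
    & (forall a x, m a -> K x -> Y (a *: x))].
Proof.
move=> Vn sU sK UK KU.
pose F : set (set V) := [set Y | [/\ submodule Y, Y `<=` K & ~ K `<=` Y]].
have FS Y : F Y -> submodule Y by case.
have FU : F U by [].
have [Y [[sY YK KY] UY maxY]] := maximal_submodule Vn FS FU.
have [x0 [Kx0 Yx0]] : exists x, K x /\ ~ Y x.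
  apply: contrapT => no; apply: KY => x Kx; apply: contrapT => Yx.
  by apply: no; exists x.
have gen v x : K v -> ~ Y v -> K x -> exists r, Y (x - r *: v).
  move=> Kv Yv Kx.
  pose T : set V := [set x | exists r, Y (x - r *: v)].
  have YT : Y `<=` T by move=> y Yy; exists 0; rewrite scale0r subr0.
  have [KT|KT] := pselect (K `<=` T); first exact: KT.
  have Tv : T v by exists 1; rewrite scale1r subrr; exact: sY.1.
  suff TY : T = Y by rewrite TY in Tv.
  apply: maxY => //; split=> //.
    split; first exact: YT sY.1.
    move=> a y z [r Yr] [t Yt]; exists (a * r + t).
    by have := sY.2 a _ _ Yr Yt; rewrite scalerBr scalerA addrACA -opprD -scalerDl.
  move=> y [r Yr]; rewrite -(subrK (r *: v) y).
  by apply: (submoduleD sK); [exact: YK | exact: (submoduleZ sK)].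
exists Y, x0; split=> // [x | a x ma Kx]; first exact: gen.
apply: contrapT => Yax.
have [|r] := gen (a *: x) x _ Yax Kx; first exact: (submoduleZ sK).
rewrite scalerA -[x in x - _]scale1r -scalerBl => Yr; apply: Yax.
have [b bE] := local_unit1B (maximal_idealMl r ma).
apply: (submoduleZ sY); rewrite -[x]scale1r -bE -scalerA.
exact: (submoduleZ sY).
Qed.

Lemma nakayama_mul V (U K : set V) a :
  noetherian_module V -> submodule U -> submodule K -> U `<=` K -> m a ->
  (forall x, K x -> exists u y, [/\ U u, K y & x = u + a *: y]) -> K `<=` U.
Proof.
move=> Vn sU sK UK ma KUa; apply: contrapT => KU.
have [Y [x0 [sY UY [Kx0 Yx0] _ mY]]] := nakayama_maximal Vn sU sK UK KU.
have [u [y [Uu Ky x0E]]] := KUa _ Kx0.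
by apply: Yx0; rewrite x0E; apply: (submoduleD sY); [exact: UY | exact: mY].
Qed.

(** ** Regular elements and the socle *)

Definition has_socle V (U : set V) : Prop :=
  exists v, ~ U v /\ forall r, m r -> U (r *: v).

Definition annihilator V (U : set V) (v : V) : set R := [set r | U (r *: v)].

Lemma annihilator_ideal V (U : set V) v :
  submodule U -> @submodule R R^o (annihilator U v).
Proof.
move=> sU; split; first by rewrite /annihilator /= scale0r; exact: sU.1.
by move=> a x y Ux Uy; rewrite /annihilator /= scalerDl -scalerA; exact: sU.2.
Qed.

Definition maximal_annihilator V (U : set V) (v : V) : Prop :=
  ~ U v /\ forall w, ~ U w -> annihilator U v `<=` annihilator U w ->
    annihilator U w = annihilator U v.

Lemma exists_maximal_annihilator V (U : set V) v : submodule U -> ~ U v ->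
  exists w, maximal_annihilator U w /\ annihilator U v `<=` annihilator U w.
Proof.
move=> sU Uv.
pose F : set (set R^o) := [set A | exists w, ~ U w /\ A = annihilator U w].
have [||A [[w [Uw ->]] vw maxw]] :=
    @maximal_submodule _ R^o F (annihilator U v)
      (fingen_noetherian R_noeth fingen_regular).
- by move=> _ [w [_ ->]]; exact: annihilator_ideal.
- by exists v.
- by exists w; split=> //; split=> // w' Uw' ww'; apply: maxw => //; exists w'.
Qed.

Lemma maximal_annihilator_prime V (U : set V) v a b : submodule U ->
  maximal_annihilator U v -> annihilator U v (a * b) ->
  annihilator U v a \/ annihilator U v b.
Proof.
move=> sU [Uv maxv] Uab; have [Ub|Ub] := pselect (U (b *: v)); first by right.
left; rewrite -(maxv _ Ub).
  by rewrite /annihilator /= scalerA.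
move=> r Ur; rewrite /annihilator /= scalerA mulrC -scalerA.
exact: (submoduleZ sU).
Qed.

(** Prime avoidance for finitely many maximal annihilators. *)
Lemma avoid_annihilators V (U : set V) (vs : seq V) : submodule U ->
  ~ has_socle U -> (forall v, v \in vs -> maximal_annihilator U v) ->
  exists z, m z /\ forall v, v \in vs -> ~ annihilator U v z.
Proof.
move=> sU nosoc; elim: vs => [_ | v vs ih vsmax].
  by exists 0; split=> //; exact: maximal_ideal_submodule.1.
have maxv := vsmax v (mem_head _ _).
have [w wvs|z [mz zvs]] := ih; first by apply: vsmax; rewrite inE wvs orbT.
have [Uz|Uz] := pselect (annihilator U v z); last first.
  by exists z; split=> // w; rewrite inE => /orP[/eqP -> | /zvs].
have [y [my Uy yvs]] :
    exists y, [/\ m y, ~ annihilator U v y & forall w, w \in vs -> annihilator U w y].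
  have [y0 [my0 Uy0]] : exists y, m y /\ ~ annihilator U v y.
    apply: contrapT => no; apply: nosoc; exists v; split; first by case: maxv.
    by move=> r mr; apply: contrapT => Ur; apply: no; exists r.
  have {vsmax} wsmax w : w \in vs -> maximal_annihilator U w.
    by move=> wvs; apply: vsmax; rewrite inE wvs orbT.
  elim: (vs) wsmax zvs => [_ _|w ws ihw wsmax zws]; first by exists y0.
  have [w' w'ws|w' w'ws|y [my Uy yws]] := ihw.
  - by apply: wsmax; rewrite inE w'ws orbT.
  - by apply: zws; rewrite inE w'ws orbT.
  have [x [Uwx Uvx]] : exists x, annihilator U w x /\ ~ annihilator U v x.
    apply: contrapT => no.
    have wv : annihilator U w `<=` annihilator U v.
      by move=> x Uwx; apply: contrapT => Uvx; apply: no; exists x.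
    apply: (zws w (mem_head _ _)).
    by rewrite -((wsmax w (mem_head _ _)).2 v _ wv) //; case: maxv.
  exists (x * y); split; first exact: maximal_idealMl.
    by case/(maximal_annihilator_prime sU maxv).
  move=> w'; rewrite inE => /orP[/eqP -> | w'ws].
    by rewrite mulrC; exact: (submoduleZ (annihilator_ideal _ sU)).
  by apply: (submoduleZ (annihilator_ideal _ sU)); exact: yws.
exists (z + y); split; first exact: (submoduleD maximal_ideal_submodule).
move=> w; rewrite inE => /orP[/eqP -> | wvs] Uzy.
  by apply: Uy; exact: (submodule_addl (annihilator_ideal v sU) Uz).
apply: (zvs _ wvs); apply: (submodule_addl (annihilator_ideal w sU) (yvs w wvs)).
by rewrite addrC.
Qed.

(** Finitely many vectors span all those with a maximal annihilator; since
    maximal annihilators are prime, each of them is the annihilator of one of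
    these finitely many vectors, and prime avoidance applies. *)
Lemma exists_regular V (U : set V) : noetherian_module V -> submodule U ->
  ~ has_socle U -> exists z, m z /\ regular_mod U z.
Proof.
move=> Vn sU nosoc.
pose F : set (set V) := [set S | exists vs : seq V,
  (forall v, v \in vs -> maximal_annihilator U v) /\ S = lspan vs].
have FS S : F S -> submodule S by move=> [vs [_ ->]]; exact: lspan_submodule.
have F0 : F [set 0] by exists [::].
have [_ [[vs [vsmax ->]] _ maxS]] := maximal_submodule Vn FS F0.
have spans w : maximal_annihilator U w -> lspan vs w.
  move=> maxw; rewrite -(maxS (lspan (w :: vs))).
  - by apply: mem_lspan; rewrite mem_head.
  - by exists (w :: vs); split=> // v; rewrite inE => /orP[/eqP -> //|/vsmax].
  - by apply: lspanS => v vvs; rewrite inE vvs orbT.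
have [z [mz zvs]] := avoid_annihilators sU nosoc vsmax.
exists z; split=> // u Uzu; apply: contrapT => Uu.
have [w [maxw uw]] := exists_maximal_annihilator sU Uu.
have [v [vvs vw]] : exists v, v \in vs /\ annihilator U v `<=` annihilator U w.
  apply: contrapT => no.
  suff [x [Uwx xvs]] : exists x, ~ annihilator U w x /\
      forall v, v \in vs -> annihilator U v x.
    apply: Uwx; have [a wE] := lspan_sumP (spans w maxw).
    rewrite /annihilator /= wE scaler_sumr; apply: (submodule_sum sU) => i _.
    rewrite scalerA mulrC -scalerA; apply: (submoduleZ sU).
    by apply: xvs; exact: mem_nth.
  elim: (vs) no => [_|v vs' ih no].
    exists 1; split=> //; rewrite /annihilator /= scale1r; by case: maxw.
  have [[v' [v'vs sub]]|x [Uwx xvs]] := ih.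
    by apply: no; exists v'; rewrite inE v'vs orbT.
  have [y [Uvy Uwy]] : exists y, annihilator U v y /\ ~ annihilator U w y.
    apply: contrapT => no'; apply: no; exists v; split; first exact: mem_head.
    by move=> y Uvy; apply: contrapT => Uwy; apply: no'; exists y.
  exists (y * x); split; first by case/(maximal_annihilator_prime sU maxw).
  move=> v'; rewrite inE => /orP[/eqP -> | v'vs].
    by rewrite mulrC; exact: (submoduleZ (annihilator_ideal _ sU)).
  by apply: (submoduleZ (annihilator_ideal _ sU)); exact: xvs.
apply: (zvs v vvs); rewrite -((vsmax v vvs).2 w maxw.1 vw); exact: uw.
Qed.

Lemma fingen_prod V V' : fingen V -> fingen V' -> fingen (V * V')%type.
Proof.
move=> /fingenP[gs gsT] /fingenP[hs hsT]; apply/fingenP.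
exists ([seq (g, 0) | g <- gs] ++ [seq (0, h) | h <- hs]).
apply/seteqP; split=> // -[x y] _.
have sS := lspan_submodule ([seq (g, 0 : V') | g <- gs] ++ [seq (0 : V, h) | h <- hs]).
have -> : (x, y) = (x, 0) + (0, y).
  by congr (_, _); rewrite /= ?addr0 ?add0r.
apply: (submoduleD sS).
  have [|a ->] := @lspan_sumP _ _ gs x; first by rewrite gsT.
  have -> : (\sum_i a i *: gs`_i, 0 : V') = \sum_i a i *: (gs`_i, 0).
    elim/big_rec2: _ => // i u v _ <-.
    by congr (_, _); rewrite /= scaler0 addr0.
  apply: (submodule_sum sS) => i _; apply: (submoduleZ sS); apply: mem_lspan.
  rewrite mem_cat; apply/orP; left; apply/mapP; exists gs`_i => //; exact: mem_nth.
have [|a ->] := @lspan_sumP _ _ hs y; first by rewrite hsT.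
have -> : (0 : V, \sum_i a i *: hs`_i) = \sum_i a i *: (0, hs`_i).
  elim/big_rec2: _ => // i u v _ <-.
  by congr (_, _); rewrite /= scaler0 addr0.
apply: (submodule_sum sS) => i _; apply: (submoduleZ sS); apply: mem_lspan.
rewrite mem_cat; apply/orP; right; apply/mapP; exists hs`_i => //; exact: mem_nth.
Qed.

(** Apply [exists_regular] to the product module. *)
Lemma exists_regular2 V V' (U : set V) (U' : set V') :
  fingen V -> fingen V' -> submodule U -> submodule U' ->
  ~ has_socle U -> ~ has_socle U' ->
  exists z, [/\ m z, regular_mod U z & regular_mod U' z].
Proof.
move=> Vfg V'fg sU sU' nU nU'.
pose P : set (V * V')%type := [set v | U v.1 /\ U' v.2].
have sP : submodule P.
  split; first by split; [exact: sU.1 | exact: sU'.1].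
  by move=> a x y [Ux Ux'] [Uy Uy']; split; [exact: sU.2 | exact: sU'.2].
have nP : ~ has_socle P.
  move=> [[v v'] [Pv mP]]; have [Uv|Uv] := pselect (U v).
    by apply: nU'; exists v'; split=> [U'v'|r /mP[]//]; exact: Pv.
  by apply: nU; exists v; split=> // r /mP[].
have [z [mz zP]] := exists_regular (fingen_noetherian R_noeth (fingen_prod Vfg V'fg)) sP nP.
exists z; split=> // [v Uv | v Uv].
  suff [] : P (v, 0) by [].
  by apply: zP; split=> //=; rewrite scaler0; exact: sU'.1.
suff [] : P (0, v) by [].
by apply: zP; split=> //=; rewrite scaler0; exact: sU.1.
Qed.

(** ** Invariance of the depth *)

(** [V / U] has a regular sequence of length [e] in [m], modulo which the
    residue field embeds: this is the nonvanishing of [Ext^e(k, V / U)], [e]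
    being least. *)
Fixpoint socle_after V (e : nat) (U : set V) : Prop :=
  if e is e'.+1 then exists b, [/\ m b, regular_mod U b & socle_after e' (add_mul U b)]
  else has_socle U.

(** If [b] and [a] are regular and [v] is a socle element modulo [b], then
    [a v = b y] modulo [U], and [y] is a socle element modulo [a]. *)
Lemma socle_exchange V (U : set V) a b : submodule U -> m a ->
  regular_mod U a -> regular_mod U b ->
  has_socle (add_mul U b) -> has_socle (add_mul U a).
Proof.
move=> sU ma aU bU [v [Ubv mv]]; have [u [y [Uu avE]]] := mv a ma.
exists y; split=> [[u' [z [Uu' yE]]] | r mr].
  apply: Ubv; exists (v - b *: z), z; split; last by rewrite subrK.
  apply: aU; rewrite scalerBr avE yE.
  have -> : u + b *: (u' + a *: z) - a *: (b *: z) = b *: u' + u.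
    by rewrite scalerDr !scalerA (mulrC b a) addrA addrK addrC.
  exact: sU.2.
have [u1 [w [Uu1 rvE]]] := mv r mr.
exists (r *: y - a *: w), w; split; last by rewrite subrK.
apply: bU.
have -> : b *: (r *: y - a *: w) = a *: u1 - r *: u.
  have H : r *: (u + b *: y) = a *: (u1 + b *: w).
    by rewrite -avE -rvE !scalerA mulrC.
  have : r *: (b *: y) = a *: u1 + a *: (b *: w) - r *: u.
    by rewrite -scalerDr -H scalerDr addrC addKr.
  rewrite scalerBr !scalerA (mulrC b r) (mulrC b a) => ->.
  by rewrite addrAC addrK.
by apply: (submoduleB sU); exact: (submoduleZ sU).
Qed.

Lemma regular_no_socle V (U : set V) a : m a -> regular_mod U a -> ~ has_socle U.
Proof. by move=> ma aU [v [Uv mv]]; apply: Uv; apply: aU; exact: mv. Qed.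

(** The submodule [K] of the [v] with [z v] in [U] satisfies [K = U + a K], so
    it is [U] by Nakayama's lemma. *)
Lemma regular_swap V (U : set V) a z : noetherian_module V -> submodule U ->
  m a -> regular_mod U a -> regular_mod (add_mul U a) z ->
  regular_mod U z /\ regular_mod (add_mul U z) a.
Proof.
move=> Vn sU ma aU zUa.
have zU : regular_mod U z.
  pose K : set V := [set v | U (z *: v)].
  have sK : submodule K.
    split; first by rewrite /K /= scaler0; exact: sU.1.
    move=> c x y Kx Ky; rewrite /K /= scalerDr scalerA mulrC -scalerA.
    exact: sU.2.
  suff KU : K `<=` U by exact: KU.
  apply: (nakayama_mul (a := a)) => //; first by move=> u; exact: (submoduleZ sU).
  move=> x Kx; have [u [w [Uu xE]]] := zUa x (@add_mulS _ _ U a _ Kx).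
  exists u, w; split=> //; apply: aU.
  rewrite scalerA mulrC -scalerA -(addKr (z *: u) (z *: (a *: w))) addrC -scalerDr -xE.
  by apply: (submoduleB sU) => //; exact: (submoduleZ sU).
split=> // v [u [w [Uu avE]]].
have [u' [w' [Uu' wE]]] : add_mul U a w.
  apply: zUa; exists (- u), v; split; first exact: (submoduleN sU).
  by rewrite avE addKr.
exists (v - z *: w'), w'; split; last by rewrite subrK.
apply: aU; rewrite scalerBr avE wE.
have -> : u + z *: (u' + a *: w') - a *: (z *: w') = z *: u' + u.
  by rewrite scalerDr !scalerA (mulrC a z) addrA addrK addrC.
exact: sU.2.
Qed.

(** The index [e] drops by one modulo every regular element [a], not only modulo
    the element [b] it was computed with: compare both with an element [z]
    regular modulo [a] and modulo [b]. *)
Lemma socle_after_regular V e (U : set V) a : fingen V -> submodule U -> m a ->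
  regular_mod U a -> socle_after e U ->
  exists e', e = e'.+1 /\ socle_after e' (add_mul U a).
Proof.
move=> Vfg; have Vn := fingen_noetherian R_noeth Vfg.
elim: e U a => [|e ih] U a sU ma aU /=; first by move/(regular_no_socle ma aU).
move=> [b [mb bU socb]]; exists e; split=> //.
case: e ih socb => [_ | e ih]; first exact: socle_exchange.
move=> socb; have [c [mc cUb _]] := socb.
have nUb := regular_no_socle mc cUb.
have nUa : ~ has_socle (add_mul U a) by move/(socle_exchange sU mb bU aU).
have [z [mz zUa zUb]] := exists_regular2 Vfg Vfg
  (add_mul_submodule a sU) (add_mul_submodule b sU) nUa nUb.
have [zU bUz] := regular_swap Vn sU mb bU zUb.
have [_ aUz] := regular_swap Vn sU ma aU zUa.
have [_ [[<-] soc1]] := ih _ _ (add_mul_submodule b sU) mz zUb socb.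
have socz : socle_after e.+1 (add_mul U z).
  by exists b; split=> //; rewrite add_mulC.
have [_ [[<-] soc2]] := ih _ _ (add_mul_submodule z sU) ma aUz socz.
by exists z; split=> //; rewrite add_mulC.
Qed.

Lemma regular_seq_le V e (U : set V) s : fingen V -> submodule U ->
  [set` s] `<=` m -> regular_seq_mod U s -> socle_after e U -> (size s <= e)%N.
Proof.
move=> Vfg; elim: s e U => //= a s ih e U sU sm [aU sreg] soc.
have ma : m a by apply: sm; rewrite /= mem_head.
have [e' [-> soc']] := socle_after_regular Vfg sU ma aU soc.
apply: (ih e') sreg soc'; first exact: add_mul_submodule.
by move=> x xs; apply: sm; rewrite /= inE xs orbT.
Qed.

(** Regular elements are added greedily, until a socle appears. *)
Lemma regular_seq_or_socle V n (U : set V) : fingen V -> submodule U ->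
  (exists s, [/\ size s = n, [set` s] `<=` m & regular_seq_mod U s]) \/
  exists2 e, (e < n)%N & socle_after e U.
Proof.
move=> Vfg; elim: n U => [|n ih] U sU; first by left; exists [::].
have [soc | nosoc] := pselect (has_socle U); first by right; exists 0%N.
have [a [ma aU]] := exists_regular (fingen_noetherian R_noeth Vfg) sU nosoc.
have [[s [sn sm sreg]] | [e en soc]] := ih _ (add_mul_submodule a sU).
  left; exists (a :: s); split=> //=; first by rewrite sn.
  by move=> x /=; rewrite inE => /orP[/eqP -> // | /sm].
by right; exists e.+1 => //; exists a.
Qed.

(** Pick the entries one by one, regular on both modules.  By the invariance of
    the depth, neither quotient acquires a socle before the last step. *)
Lemma common_regular_seq V V' (U : set V) (U' : set V') (s s' : seq R) :
  fingen V -> fingen V' -> submodule U -> submodule U' -> size s = size s' ->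
  [set` s] `<=` m -> [set` s'] `<=` m ->
  regular_seq_mod U s -> regular_seq_mod U' s' ->
  exists t, [/\ size t = size s, [set` t] `<=` m,
    regular_seq_mod U t & regular_seq_mod U' t].
Proof.
move=> Vfg V'fg; have [n sn] : {n | size s = n} by exists (size s).
rewrite sn => + + /esym.
elim: n U U' s s' sn => [|n ih] U U' s s' sn sU sU' s'n sm s'm sreg s'reg.
  by exists [::].
have step (W : lmodType R) (T : set W) t : fingen W -> submodule T -> size t = n.+1 ->
    [set` t] `<=` m -> regular_seq_mod T t -> ~ has_socle T /\
    forall z, m z -> regular_mod T z ->
    exists t', [/\ size t' = n, [set` t'] `<=` m & regular_seq_mod (add_mul T z) t'].
  move=> Wfg sT tn tm treg; split.
    move=> soc; have := @regular_seq_le _ 0 _ _ Wfg sT tm treg soc.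
    by rewrite tn.
  move=> z mz zT; case: (@regular_seq_or_socle _ n (add_mul T z) Wfg) => //.
    exact: add_mul_submodule.
  move=> [e en soc]; have socT : socle_after e.+1 T by exists z.
  by have := regular_seq_le Wfg sT tm treg socT; rewrite tn ltnS leqNgt en.
have [nU drop] := step _ _ _ Vfg sU sn sm sreg.
have [nU' drop'] := step _ _ _ V'fg sU' s'n s'm s'reg.
have [z [mz zU zU']] := exists_regular2 Vfg V'fg sU sU' nU nU'.
have [t [tn tm treg]] := drop z mz zU.
have [t' [t'n t'm t'reg]] := drop' z mz zU'.
have [r [rn rm rreg rreg']] := ih _ _ _ _ tn (add_mul_submodule z sU)
  (add_mul_submodule z sU') t'n tm t'm treg t'reg.
exists (z :: r); split=> //=; first by rewrite rn.
by move=> x /=; rewrite inE => /orP[/eqP -> // | /rm].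
Qed.

End Local.

(** * Regular sequences of length the Krull dimension *)

Section KrullDimension.
Variables (R : comNzRingType) (m : set R).
Hypotheses (R_noeth : noetherian_ring R) (R_local : local_ring m).
Implicit Types V : lmodType R.

(** An ideal containing [I] and maximal among those that miss the
    multiplicative set of the [y * x ^+ n] with [y] outside [p] is prime. *)
Lemma prime_below (I p : set R) (x : R) : @submodule R R^o I -> prime_ideal p ->
  I `<=` p -> p x -> @regular_mod R R^o I x ->
  exists q, [/\ prime_ideal q, I `<=` q & q `<` p].
Proof.
move=> sI [pI p1 pM] Ip px xI.
pose T : set R := [set t | exists y n, ~ p y /\ t = y * x ^+ n].
pose F : set (set R^o) := [set J : set R^o | submodule J /\ forall t, T t -> ~ J t].
have TM t u : T t -> T u -> T (t * u).
  move=> [y [n [py ->]]] [z [k [pz ->]]]; exists (y * z), (n + k)%N; split.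
    by case/pM.
  by rewrite exprD mulrACA.
have FI : F I.
  split=> // _ [y [n [py ->]]] Iyx; apply: py; apply: Ip.
  elim: n Iyx => [|n ih]; first by rewrite expr0 mulr1.
  by rewrite exprS mulrCA => /xI; exact: ih.
have [q [[sq Tq] Iq maxq]] := maximal_submodule
  (fingen_noetherian R_noeth (fingen_regular R)) (fun S => @proj1 _ _) FI.
have Ty y : ~ p y -> T y by exists y, 0%N; rewrite mulr1.
have grow a : ~ q a -> exists t r, T t /\ q (t - r * a).
  move=> qa; apply: contrapT => no.
  pose Q : set R^o := [set b | exists r, q (b - r * a)].
  have qQ : q `<=` Q by move=> b qb; exists 0; rewrite mul0r subr0.
  have Qq : Q = q.
    apply: maxq => //; split.
      split; first exact: qQ sq.1.
      move=> c b b' [r qb] [r' qb']; exists (c * r + r').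
      have := sq.2 c _ _ qb qb'.
      by rewrite scalerBr addrACA -opprD mulrDl -mulrA.
    by move=> t Tt [r qtr]; apply: no; exists t, r.
  by apply: qa; rewrite -Qq; exists 1; rewrite mul1r subrr; exact: sq.1.
exists q; split=> //.
- split; first exact/ideal_submodule.
    by apply: Tq; apply: Ty.
  move=> a b qab; apply: contrapT => /not_orP[qa qb].
  have [t [r [Tt qt]]] := grow a qa; have [u [r' [Tu qu]]] := grow b qb.
  apply: (Tq (t * u)); first exact: TM.
  have -> : t * u = u * (t - r * a) + (r * a) * (u - r' * b) + (r * r') * (a * b).
    rewrite !mulrBr [u * t]mulrC (mulrC u) addrA subrK.
    by rewrite [r' * b]mulrC mulrA -[r * a * b]mulrA mulrAC -!mulrA mulrCA subrK.
  apply: (submoduleD sq); first apply: (submoduleD sq).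
  + exact: (submoduleZ sq).
  + exact: (submoduleZ sq).
  + exact: (submoduleZ sq).
- split=> [y qy|].
    by apply: contrapT => py; exact: (Tq y (Ty y py)).
  move=> /(_ x px); apply: Tq; exists 1, 1%N; split=> //.
  by rewrite mul1r expr1.
Qed.

Lemma prime_chain_below (s : seq R) (p : set R) :
  @regular_seq_mod R R^o [set 0] s -> prime_ideal p ->
  @add_muls R R^o [set 0] s `<=` p ->
  exists q, prime_chain (size s) q /\ q (size s) = p.
Proof.
elim/last_ind: s p => [p _ pp _ | s x ih p].
  by exists (fun=> p); split=> //; split=> // -[].
rewrite -{1}cats1 => /regular_seq_mod_cat[sreg [/= xreg _]] pp.
rewrite add_muls_rcons => Jp.
have sJ : submodule (@add_muls R R^o [set 0] s).
  exact: add_muls_submodule (submodule0 _).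
have px : p x.
  apply: Jp; exists 0, 1; split; first exact: sJ.1.
  by rewrite add0r /GRing.scale /= mulr1.
have Jp' := subset_trans (@add_mulS _ _ _ x) Jp.
have [q [qp Jq qltp]] := prime_below sJ pp Jp' px xreg.
have [c [[cp clt] cq]] := ih q sreg qp Jq.
exists (fun i => if (i <= size s)%N then c i else p); rewrite size_rcons.
split; last by rewrite ltnn.
split=> i; first by case: ifP => // + _ => /cp.
rewrite ltnS => lei; rewrite lei; case: ltnP => [/clt // | gei].
by have -> : i = size s by [apply/eqP; rewrite eqn_leq lei]; rewrite cq.
Qed.

Variable s : seq R.
Hypotheses (s_dim : krull_dim_is R (size s))
  (s_reg : @regular_seq_mod R R^o [set 0] s).
Let J : set R := @add_muls R R^o [set 0] s.

(** A prime [p] over [J] other than [m] would give, with the chain below [p] and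
    [m] on top, a chain longer than the dimension. *)
Lemma prime_over_parameters (p : set R) : prime_ideal p -> J `<=` p -> p = m.
Proof.
move=> pp Jp; have [c [[cp clt] cq]] := prime_chain_below s_reg pp Jp.
have pm : p `<=` m.
  move=> a pa; apply: contrapT => /(local_unit R_noeth R_local)[b ba].
  by case: pp => -[_ _ pM] p1 _; apply: p1; rewrite -ba; exact: pM.
apply: contrapT => pneqm.
suff : prime_chain (size s).+1 (fun i => if (i <= size s)%N then c i else m).
  by move/(s_dim.2); rewrite ltnn.
split=> i.
  case: ifP => [/cp // | _ _]; split.
  - by case: R_local => -[].
  - exact: maximal_ideal_proper R_local.
  - move=> x y mxy; apply: contrapT => /not_orP[].
    move=> /(local_unit R_noeth R_local)[a ax] /(local_unit R_noeth R_local)[b bby].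
    apply: (maximal_ideal_proper R_local).
    have -> : 1 = (a * b) * (x * y) by rewrite mulrACA ax bby mulr1.
    exact: maximal_idealMl R_local _ _ mxy.
rewrite ltnS => lei; rewrite lei; case: ltnP => [/clt // | gei].
have -> : i = size s by [apply/eqP; rewrite eqn_leq lei]; rewrite cq.
by split=> // mp; apply: pneqm; exact/seteqP.
Qed.

(** The maximal annihilators of [V / U] are prime and contain [J], so they are
    equal to [m]. *)
Lemma parameters_has_socle V (U : set V) : submodule U -> U <> setT ->
  (forall a v, J a -> U (a *: v)) -> has_socle m U.
Proof.
move=> sU UT JU.
have [v Uv] : exists v, ~ U v.
  apply: contrapT => no; apply: UT; apply/seteqP; split=> // v _.
  by apply: contrapT => Uv; apply: no; exists v.
have [w [maxw _]] := exists_maximal_annihilator R_noeth sU Uv.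
have annm : annihilator U w = m.
  apply: prime_over_parameters; last by move=> a; exact: JU.
  split; first by apply/ideal_submodule; exact: annihilator_ideal.
    by rewrite /annihilator /= scale1r; case: maxw.
  by move=> a b; exact: maximal_annihilator_prime.
by exists w; split; [case: maxw | move=> r; rewrite -annm].
Qed.

End KrullDimension.

(** * Divisible groups and injective modules *)

Section Divisible.

Definition divisible (D : zmodType) : Prop :=
  forall (d : D) n, (0 < n)%N -> exists c, c *+ n = d.

Lemma int_subgroup (P : set int) : P 0 -> (forall j k, P j -> P k -> P (j - k)) ->
  exists q : nat, forall k, P k <-> (q %| k)%Z.
Proof.
move=> P0 PB.
have PN k : P k -> P (- k) by rewrite -[- k]add0r; exact: PB.
have PD j k : P j -> P k -> P (j + k) by move=> Pj /PN Pk; rewrite -[k]opprK; exact: PB.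
have PM (j k : int) : P k -> P (j * k).
  move=> Pk.
  have Pnat n : P (n%:Z * k).
    elim: n => [|n ih]; first by rewrite mul0r.
    by rewrite -addn1 PoszD mulrDl mul1r; exact: PD.
  by case: (intP j) => [|n|n]; rewrite ?mul0r // mulNr; exact/PN.
have [[n Pn] | no] := pselect (exists n, P n.+1%:Z); last first.
  exists 0%N => k; rewrite dvd0z; split=> [Pk|/eqP -> //].
  case: (intP k) Pk => // n Pn; case: no; exists n => //.
  by rewrite -[_%:Z]opprK; exact: PN.
have ex : exists n, `[< P n.+1%:Z >] by exists n; exact/asboolP.
have [q /asboolP Pq minq] := ex_minnP ex; exists q.+1 => k; split; last first.
  by move/dvdzP => [j ->]; exact: PM.
move=> Pk; apply/dvdz_mod0P; apply: contrapT => /eqP r0.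
have: P (k %% q.+1)%Z by rewrite /modz; apply: PB => //; exact: PM.
have := @ltz_pmod k q.+1 isT; have := modz_ge0 k (d := q.+1) isT.
case: (k %% q.+1)%Z r0 => // -[//|r] _ _ ltr Pr.
by have := minq r (asboolT Pr); rewrite leqNgt -ltnS -ltz_nat ltr.
Qed.

(** The graph of a partial additive map. *)
Definition partial_hom (B D : zmodType) (G : set (B * D)%type) : Prop :=
  [/\ G 0, (forall u v, G u -> G v -> G (u - v)) & (forall y, G (0, y) -> y = 0)].

Lemma partial_hom_fun (B D : zmodType) (G : set (B * D)%type) x y y' :
  partial_hom G -> G (x, y) -> G (x, y') -> y = y'.
Proof.
move=> [_ GB G0] Gy Gy'; apply/subr0_eq; apply: G0.
suff <- : (x, y) - (x, y') = (0, y - y') by exact: GB.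
by congr (_, _); exact: subrr.
Qed.

(** The multiples of [b] in the domain are those by multiples of some [q];
    divisibility provides a value [c] at [b] with [c *+ q] prescribed. *)
Lemma partial_hom_step (B D : zmodType) (G : set (B * D)%type) b :
  divisible D -> partial_hom G ->
  exists G', [/\ partial_hom G', G `<=` G' & exists y, G' (b, y)].
Proof.
move=> Ddiv [G0 GB Gf]; have Ghom : partial_hom G by [].
have GN u : G u -> G (- u) by rewrite -[- u]add0r; exact: GB.
have GD u v : G u -> G v -> G (u + v).
  by move=> Gu /GN Gv; rewrite -[v]opprK; exact: GB.
pose P : set int := [set k | exists y, G (b *~ k, y)].
have [||q qP] := @int_subgroup P.
- by exists 0; rewrite mulr0z.
- move=> j k [y Gy] [z Gz]; exists (y - z).
  by have := GB _ _ Gy Gz; rewrite mulrzBr.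
have [c cP] : exists c : D, forall k y, G (b *~ k, y) -> y = c *~ k.
  have [yq Gyq] : P q by apply/qP; exact: dvdzz.
  have [c cE] : exists c : D, c *+ q = yq.
    case: (q) Gyq => [Gy0|q' Gq]; last exact: Ddiv.
    by exists 0; rewrite mulr0n; apply/esym/Gf.
  exists c => k y Gy; have /dvdzP[j kE] : (q %| k)%Z by apply/qP; exists y.
  apply: (partial_hom_fun Ghom Gy).
  have Gmul i : G ((b *~ q) *~ i, yq *~ i).
    have Gnat n : G ((b *~ q) *+ n, yq *+ n).
      elim: n => [|n ih]; first by rewrite !mulr0n.
      by rewrite !mulrS; apply: (GD (_, _) (_, _)).
    case: (intP i) => [|n|n]; first by rewrite !mulr0z.
      exact: Gnat.
    by rewrite !mulrNz; apply: (GN (_, _)); exact: Gnat.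
  have := Gmul j; rewrite -cE kE -mulrzA mulrC.
  by rewrite -[c *+ q]/(c *~ q) -mulrzA [j * _]mulrC.
exists [set u | exists v k, G v /\ u = v + (b *~ k, c *~ k)]; split.
- split.
  + by exists 0, 0; split=> //; rewrite !mulr0z addr0.
  + move=> _ _ [v [k [Gv ->]]] [w [j [Gw ->]]]; exists (v - w), (k - j).
    split; first exact: GB.
    by rewrite !mulrzBr opprD addrACA.
  + move=> y [[v1 v2] [k [Gv [v1E ->]]]].
    have := cP (- k) v2; rewrite !mulrNz => -> //; first by rewrite addNr.
    suff <- : v1 = - (b *~ k) by [].
    by apply/eqP; rewrite -addr_eq0 -v1E.
- by move=> u Gu; exists u, 0; split=> //; rewrite !mulr0z addr0.
- by exists c, 0, 1; split=> //; rewrite !mulr1z add0r.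
Qed.

Lemma divisible_extension (B D : zmodType) (G : set (B * D)%type) :
  divisible D -> partial_hom G ->
  exists h : B -> D, (forall x y, h (x + y) = h x + h y) /\
    forall u, G u -> h u.1 = u.2.
Proof.
move=> Ddiv Ghom.
(* the union of the empty chain is empty, hence the first alternative *)
pose P (A : set (B * D)%type) := A = set0 \/ (partial_hom A /\ G `<=` A).
have [|A [PA maxA]] := @Zorn_bigcup _ P.
  move=> C CP totC.
  have [[X0 [CX0 [hX0 GX0]]] | noX] :=
      pselect (exists X, C X /\ (partial_hom X /\ G `<=` X)); last first.
    left; apply/seteqP; split=> // x [X CX Xx].
    have [X0 | hX] := CP X CX; first by rewrite X0 in Xx.
    by case: noX; exists X.
  have good X x : C X -> X x -> partial_hom X.
    by move=> CX Xx; have [X0' | []//] := CP X CX; rewrite X0' in Xx.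
  right; split; last by move=> x Gx; exists X0 => //; exact: GX0.
  split; first by exists X0 => //; case: hX0.
    move=> u v [X CX Xu] [Y CY Yv].
    have [XY | YX] := totC X Y CX CY.
      exists Y => //; have [_ YB _] := good Y v CY Yv; apply: YB => //; exact: XY.
    exists X => //; have [_ XB _] := good X u CX Xu; apply: XB => //; exact: YX.
  by move=> y [X CX Xy]; have [_ _ Xf] := good X _ CX Xy; exact: Xf.
have [hA GA] : partial_hom A /\ G `<=` A.
  case: PA => // A0; case: (maxA G); last by right; split.
  rewrite A0; split; first exact: sub0set.
  by move=> /(_ 0); case: Ghom => G0 _ _; exact.
have /choice[h hP] b : exists y, A (b, y).
  have [A' [hA' AA' [y A'y]]] := partial_hom_step b Ddiv hA.
  exists y; apply: contrapT => Ay; apply: (maxA A').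
    by split=> // A'A; apply: Ay; exact: A'A.
  by right; split=> // u /GA; exact: AA'.
exists h; split=> [x y|[x y] Gxy].
  have [A0 AB _] := hA.
  have Axy : A (x + y, h x + h y).
    have := AB _ _ (hP x) (AB _ _ A0 (hP y)).
    by rewrite sub0r opprK.
  exact: (partial_hom_fun hA (hP _) Axy).
by apply: (partial_hom_fun hA (hP x)); exact: GA.
Qed.

Definition int_rat : {pred rat} := fun x => x \is a Num.int.

Fact int_rat_zmod : zmod_closed int_rat.
Proof. by split=> [|x y]; [exact: rpred0 | exact: rpredB]. Qed.
HB.instance Definition _ := GRing.isZmodClosed.Build rat int_rat int_rat_zmod.

Definition QmodZ : zmodType := Quotient.quot (int_rat : zmodClosed rat).
Definition QtoQmodZ (x : rat) : QmodZ := \pi_(Quotient.quot (int_rat : zmodClosed rat))%qT x.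

Lemma QtoQmodZD x y : QtoQmodZ (x + y) = QtoQmodZ x + QtoQmodZ y.
Proof. exact: (Quotient.pi_add (int_rat : zmodClosed rat)). Qed.

Lemma QtoQmodZ0 : QtoQmodZ 0 = 0.
Proof. by apply: (addrI (QtoQmodZ 0)); rewrite -QtoQmodZD !addr0. Qed.

Lemma QmodZ_mulrn x n : QtoQmodZ x *+ n = QtoQmodZ (x *+ n).
Proof.
elim: n => [|n ih]; first by rewrite !mulr0n QtoQmodZ0.
by rewrite !mulrS ih QtoQmodZD.
Qed.

Lemma QmodZ_eq0 x : (QtoQmodZ x == 0) = (x \is a Num.int).
Proof.
rewrite -QtoQmodZ0 -[x in RHS]subr0; apply/esym.
exact: (Quotient.idealrBE (int_rat : zmodClosed rat) x 0).
Qed.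

Lemma QmodZ_divisible : divisible QmodZ.
Proof.
move=> d n n0; exists (QtoQmodZ (repr (d : Quotient.quot (int_rat : zmodClosed rat)) / n%:R)).
rewrite QmodZ_mulrn -[_ / _ *+ n]mulr_natr divfK ?pnatr_eq0 -?lt0n //.
exact: reprK.
Qed.

Lemma QmodZ_torsion n : (1 < n)%N -> exists c : QmodZ, c != 0 /\ c *+ n = 0.
Proof.
move=> n1; exists (QtoQmodZ n%:R^-1); split.
  rewrite QmodZ_eq0; apply/negP => /intrP[k kE].
  have : ((0 : rat) < k%:~R) && (k%:~R < (1 : rat)).
    by rewrite -kE invr_gt0 ltr0n (ltnW n1) /= invf_lt1 ?ltr0n ?ltr1n ?(ltnW n1).
  rewrite ltr0z (ltr_int rat k 1) => /andP[k0].
  by rewrite ltNge -gtz0_ge1 k0.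
rewrite QmodZ_mulrn; apply/eqP; rewrite QmodZ_eq0 -[_^-1 *+ n]mulr_natr mulVf //.
by rewrite pnatr_eq0 -lt0n ltnW.
Qed.

(** Modulo [S] the element [b] generates a cyclic group of order [q] different
    from one, infinite when [q] is zero; such a group has a nonzero map to
    [QmodZ], which extends. *)
Lemma QmodZ_separates (B : zmodType) (S : set B) (b : B) : S 0 ->
  (forall x y, S x -> S y -> S (x - y)) -> ~ S b ->
  exists h : B -> QmodZ, [/\ forall x y, h (x + y) = h x + h y,
    (forall x, S x -> h x = 0) & h b != 0].
Proof.
move=> S0 SB Sb.
have [||q qP] := @int_subgroup [set k | S (b *~ k)].
- by rewrite /= mulr0z.
- by move=> j k /= Sj Sk; rewrite mulrzBr; exact: SB.
have [c [c0 cq]] : exists c : QmodZ, c != 0 /\ c *+ q = 0.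
  case: q qP => [|[|q]] qP; last exact: QmodZ_torsion.
    by have [c [c0 _]] := @QmodZ_torsion 2 isT; exists c; rewrite mulr0n.
  by case: Sb; rewrite -[b]mulr1z; apply/qP.
pose G : set (B * QmodZ)%type := [set u | exists y k, S y /\ u = (y + b *~ k, c *~ k)].
have [|h [hD hG]] := divisible_extension QmodZ_divisible (_ : partial_hom G).
  split.
  - by exists 0, 0; rewrite !mulr0z addr0.
  - move=> _ _ [y [k [Sy ->]]] [z [j [Sz ->]]]; exists (y - z), (k - j).
    split; first exact: SB.
    by rewrite !mulrzBr addrACA -opprD.
  - move=> _ [y [k [Sy [yE ->]]]].
    have : S (b *~ k).
      have -> : b *~ k = 0 - y by rewrite yE addrC addKr.
      exact: SB.
    move/qP/dvdzP => [j ->].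
    by rewrite mulrC mulrzA -[c *~ _]/(c *+ q) cq mul0rz.
exists h; split=> // [x Sx|].
  by apply: (hG (x, 0)); exists x, 0; rewrite !mulr0z addr0.
suff -> : h b = c by [].
by apply: (hG (b, c)); exists 0, 1; rewrite !mulr1z add0r.
Qed.

End Divisible.

Local Notation "s ** V" := (@add_muls _ V [set 0] s) (at level 40).

(** * Linear maps and submodules as modules *)

Section LinearMaps.
Variables (R : comNzRingType).
Implicit Types V A B E : lmodType R.

Lemma linear_map A B (f : A -> B) : linear f -> exists h : {linear A -> B}, h =1 f.
Proof.
move=> flin; pose h := GRing.isLinear.Build R A B *:%R _ flin.
by pose H : {linear A -> B} := HB.pack f h; exists H.
Qed.

Lemma bilinear_map A B V (f : A -> B -> V) :
  (forall b, linear (f^~ b)) -> (forall a, linear (f a)) ->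
  exists h : {bilinear A -> B -> V}, forall a b, h a b = f a b.
Proof.
move=> fl fr.
have flin : bilinear_for *:%R *:%R f.
  by split=> [b c a a' | a c b b']; [exact: fl | exact: fr].
pose h := bilinear_isBilinear.Build R A B V *:%R *:%R f flin.
by pose H : {bilinear A -> B -> V} := HB.pack f h; exists H.
Qed.

Section SubmoduleType.
Variables (V : lmodType R) (S : set V) (sS : submodule S).

Definition submodule_pred : {pred V} := fun x => `[< S x >].
Record submodule_sort :=
  SubmoduleSort { submodule_val : V; _ : submodule_val \in submodule_pred }.
HB.instance Definition _ := [isSub for submodule_val].
HB.instance Definition _ := [Choice of submodule_sort by <:].

Fact submodule_pred_closed : subsemimod_closed submodule_pred.
Proof.
split; first split.
- by apply/asboolP; exact: sS.1.
- by move=> x y /asboolP Sx /asboolP Sy; apply/asboolP; exact: (submoduleD sS).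
- by move=> a x /asboolP Sx; apply/asboolP; exact: (submoduleZ sS).
Qed.
HB.instance Definition _ := GRing.SubChoice_isSubLmodule.Build R V submodule_pred
  submodule_sort submodule_pred_closed.

Lemma submodule_type : exists (U : lmodType R) (i : {linear U -> V}),
  injective i /\ forall x, S x <-> exists z, i z = x.
Proof.
exists submodule_sort, (\val : submodule_sort -> V).
split=> [|x]; first exact: val_inj.
split=> [Sx | [z <-]]; last exact/asboolP/(valP z).
by exists (SubmoduleSort (asboolT Sx : x \in submodule_pred)).
Qed.

End SubmoduleType.

Lemma ker_submodule A B (f : {linear A -> B}) : submodule [set a | f a = 0].
Proof.
split; first by rewrite /= linear0.
by move=> a x y /= fx fy; rewrite linearP fx fy scaler0 addr0.
Qed.

Lemma preimage_submodule A B (f : {linear A -> B}) (S : set B) :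
  submodule S -> submodule [set a | S (f a)].
Proof.
move=> sS; split; first by rewrite /= linear0; exact: sS.1.
by move=> a x y /= fx fy; rewrite linearP; exact: sS.2.
Qed.

Lemma image_submodule A B (f : {linear A -> B}) : submodule (range f).
Proof.
split; first by exists 0 => //; rewrite linear0.
by move=> a _ _ [x _ <-] [y _ <-]; exists (a *: x + y) => //; rewrite linearP.
Qed.

Lemma add_muls_sub V (U W : set V) s : submodule U -> W `<=` U ->
  (forall a v, a \in s -> U (a *: v)) -> add_muls W s `<=` U.
Proof.
move=> sU; elim: s W => //= a s ih W WU sU'; apply: ih.
  move=> _ [w [v [Ww ->]]]; apply: (submoduleD sU); first exact: WU.
  by apply: sU'; rewrite mem_head.
by move=> b v bs; apply: sU'; rewrite inE bs orbT.
Qed.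

Lemma add_mulsS V (W : set V) s : W `<=` add_muls W s.
Proof.
elim: s W => [|a s ih] W //=; apply: subset_trans (ih _); exact: add_mulS.
Qed.

Lemma add_muls_mem V (W : set V) s a v : submodule W -> a \in s ->
  add_muls W s (a *: v).
Proof.
elim: s W => [|b s ih] W sW //=; rewrite inE => /orP[/eqP -> | ats].
  by apply: (@add_mulsS _ (add_mul W b)); exact: add_mul_mem.
by apply: ih => //; exact: add_mul_submodule.
Qed.

Lemma smul_submodule V s : submodule (s ** V).
Proof. exact: add_muls_submodule (submodule0 _). Qed.

Lemma smul_mem V s a (v : V) : a \in s -> (s ** V) (a *: v).
Proof. exact: add_muls_mem (submodule0 _). Qed.

Lemma smul_sub V (U : set V) s : submodule U ->
  (forall a v, a \in s -> U (a *: v)) -> s ** V `<=` U.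
Proof. by move=> sU; apply: add_muls_sub => // _ ->; exact: sU.1. Qed.

Lemma smul_map A B (f : {linear A -> B}) s a : (s ** A) a -> (s ** B) (f a).
Proof.
apply: (@smul_sub _ [set a | (s ** B) (f a)]).
  exact: preimage_submodule (smul_submodule B s).
by move=> c v cs /=; rewrite linearZ; exact: smul_mem.
Qed.

Lemma smul_killed A B (f : {linear A -> B}) s a :
  (forall c x, c \in s -> c *: f x = 0) -> (s ** A) a -> f a = 0.
Proof.
move=> fs; apply: (@smul_sub _ [set a | f a = 0]); first exact: ker_submodule.
by move=> c v cs /=; rewrite linearZ; exact: fs.
Qed.

Lemma smul_monotone V s t : {subset s <= t} -> s ** V `<=` t ** V.
Proof.
move=> st; apply: smul_sub; first exact: smul_submodule.
by move=> a v /st; exact: smul_mem.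
Qed.

(** ** Injective modules *)

(** Injectivity of [E] over [R / (s)], phrased over [R]: the hypothesis on [g]
    says that it factors through the image of [A] in [B / s B]. *)
Definition seq_injective (s : seq R) E : Prop :=
  (forall c (x : E), c \in s -> c *: x = 0) /\
  forall A B (j : {linear A -> B}) (g : {linear A -> E}),
    (forall a, (s ** B) (j a) -> g a = 0) ->
    exists h : {linear B -> E}, forall a, h (j a) = g a.

Lemma injective_extend E A B (j : {linear A -> B}) (g : {linear A -> E}) :
  injective_module E -> (forall a, j a = 0 -> g a = 0) ->
  exists h : {linear B -> E}, forall a, h (j a) = g a.
Proof.
move=> Einj jg; have [U [i [iinj iU]]] := submodule_type (image_submodule j).
have /choice[k kP] (u : U) : exists a, j a = i u.
  have : exists z, i z = i u by exists u.
  by move/(iU (i u)).2 => -[a _ <-]; exists a.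
have gk a u : j a = i u -> g a = g (k u).
  move=> jai; apply/subr0_eq; rewrite -linearB; apply: jg.
  by rewrite linearB /= jai kP subrr.
have [g' g'E] : exists g' : {linear U -> E}, g' =1 g \o k.
  apply: linear_map => c u v /=; rewrite -linearP; apply/esym/gk.
  by rewrite linearP !kP linearP.
have [h hE] := Einj _ _ i g' iinj; exists h => a.
have : range j (j a) by exists a.
by move/(iU _).1 => [u iu]; rewrite -iu hE g'E /= -(gk a).
Qed.

(** Extend the map [(a, b) |-> g a] along [(a, b) |-> j a + c b]: the extension
    vanishes on [c B]. *)
Lemma injective_extend_killed E A B (j : {linear A -> B}) (g : {linear A -> E}) s :
  injective_module E -> (forall a, (s ** B) (j a) -> g a = 0) ->
  exists h : {linear B -> E}, (forall a, h (j a) = g a) /\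
    forall c b, c \in s -> c *: h b = 0.
Proof.
move=> Einj; elim: s A j g => [|c s ih] A j g jg.
  by have [h hE] := injective_extend Einj jg; exists h.
have [j' j'E] : exists j' : {linear (A * B)%type -> B},
    j' =1 fun u => j u.1 + c *: u.2.
  apply: linear_map => a u v /=.
  by rewrite linearP !scalerDr !scalerA addrACA mulrC.
have [g' g'E] : exists g' : {linear (A * B)%type -> E}, g' =1 fun u => g u.1.
  by apply: linear_map => a u v /=; rewrite linearP.
have [[a b]|h [hj hs]] := ih _ j' g'.
  rewrite j'E g'E /= => sj; apply: jg.
  have sB := smul_submodule B (c :: s).
  rewrite -[j a](addrK (c *: b)); apply: (submoduleB sB).
    by apply: smul_monotone sj => d ds; rewrite inE ds orbT.
  by apply: smul_mem; rewrite mem_head.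
exists h; split=> [a | d b].
  by have := hj (a, 0); rewrite j'E g'E /= scaler0 addr0.
rewrite inE => /orP[/eqP -> | /hs //].
by rewrite -linearZ; have := hj (0, b); rewrite j'E g'E /= !linear0 add0r.
Qed.

Lemma killed_submodule E (s : seq R) :
  submodule [set x : E | forall c, c \in s -> c *: x = 0].
Proof.
split=> [c _|a x y kx ky c cs]; first by rewrite scaler0.
by rewrite scalerDr scalerA mulrC -scalerA kx // ky // scaler0 addr0.
Qed.

(** The dual [Hom_Z(R, Q/Z)] of [R]. *)
Record dual_ring := DualRing { dual_fun :> R -> QmodZ;
  dual_funD : forall x y, dual_fun (x + y) = dual_fun x + dual_fun y }.

HB.instance Definition _ := gen_eqMixin dual_ring.
HB.instance Definition _ := gen_choiceMixin dual_ring.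

Lemma dual_ext (f g : dual_ring) : dual_fun f = dual_fun g -> f = g.
Proof.
case: f g => [f fD] [g gD] /= fg; case: g / fg gD => gD.
by congr DualRing; exact: Prop_irrelevance.
Qed.

Program Definition dual_zero := @DualRing (fun=> 0) _.
Next Obligation. by rewrite addr0. Qed.
Program Definition dual_add (f g : dual_ring) := @DualRing (fun x => f x + g x) _.
Next Obligation. by rewrite !dual_funD addrACA. Qed.
Program Definition dual_opp (f : dual_ring) := @DualRing (fun x => - f x) _.
Next Obligation. by rewrite dual_funD opprD. Qed.
Program Definition dual_scale a (f : dual_ring) := @DualRing (fun x => f (x * a)) _.
Next Obligation. by rewrite mulrDl dual_funD. Qed.

Fact dual_addA : associative dual_add.
Proof. by move=> f g h; apply/dual_ext/funext => x /=; rewrite addrA. Qed.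
Fact dual_addC : commutative dual_add.
Proof. by move=> f g; apply/dual_ext/funext => x /=; rewrite addrC. Qed.
Fact dual_add0 : left_id dual_zero dual_add.
Proof. by move=> f; apply/dual_ext/funext => x /=; rewrite add0r. Qed.
Fact dual_addN : left_inverse dual_zero dual_opp dual_add.
Proof. by move=> f; apply/dual_ext/funext => x /=; rewrite addNr. Qed.
HB.instance Definition _ := GRing.isZmodule.Build dual_ring
  dual_addA dual_addC dual_add0 dual_addN.

Fact dual_scaleA a b f : dual_scale a (dual_scale b f) = dual_scale (a * b) f.
Proof. by apply/dual_ext/funext => x /=; rewrite mulrA. Qed.
Fact dual_scale1 : left_id 1 dual_scale.
Proof. by move=> f; apply/dual_ext/funext => x /=; rewrite mulr1. Qed.
Fact dual_scaleDr : right_distributive dual_scale +%R.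
Proof. by move=> a f g; apply/dual_ext/funext. Qed.
Fact dual_scaleDl f : {morph dual_scale^~ f : a b / a + b}.
Proof. by move=> a b; apply/dual_ext/funext => x /=; rewrite mulrDr dual_funD. Qed.
HB.instance Definition _ := GRing.Zmodule_isLmodule.Build R dual_ring
  dual_scaleA dual_scale1 dual_scaleDr dual_scaleDl.

(** Linear maps [A -> dual_ring] are the additive maps [A -> QmodZ], by
    evaluation at [1]. *)
Lemma dual_ring_injective : injective_module dual_ring.
Proof.
move=> A B j g jinj.
pose G : set (B * QmodZ)%type := [set u | exists a, u = (j a, g a 1)].
have [|h [hD hG]] := divisible_extension QmodZ_divisible (_ : partial_hom G).
  split.
  - by exists 0; rewrite !linear0.
  - by move=> _ _ [a ->] [b ->]; exists (a - b); rewrite !linearB.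
  - by move=> y [a [ja ->]]; rewrite (_ : a = 0) ?linear0 //; apply: jinj; rewrite linear0.
have hb b : forall x y, h ((x + y) *: b) = h (x *: b) + h (y *: b).
  by move=> x y; rewrite scalerDl hD.
have [k kE] : exists k : {linear B -> dual_ring}, k =1 fun b => DualRing (hb b).
  apply: linear_map => c u v; apply/dual_ext/funext => x /=.
  by rewrite scalerDr hD scalerA.
exists k => a; rewrite kE; apply/dual_ext/funext => x /=.
rewrite -linearZ (hG (j (x *: a), g (x *: a) 1)); last by exists (x *: a).
by rewrite /= linearZ /= mul1r.
Qed.

(** The module is [Hom_Z(R / (s), Q / Z)], realized inside the injective module
    [dual_ring] as the part annihilated by [s]; an additive map that does not
    vanish at [c] is an element not annihilated by [c]. *)
Lemma exists_seq_injective (s : seq R) (c : R) : ~ (s ** R^o) c ->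
  exists (W : lmodType R) (w : W), seq_injective s W /\ c *: w <> 0.
Proof.
move=> sc; have sJ := smul_submodule R^o s.
have [h [hD hJ hc]] := QmodZ_separates sJ.1 (fun x y => @submoduleB _ _ _ sJ x y) sc.
have [W [i [iinj iW]]] := submodule_type (killed_submodule dual_ring s).
have [w wE] : exists w, i w = DualRing hD.
  apply/iW => a a_s; apply/dual_ext/funext => x /=; apply: hJ.
  by have := @smul_mem R^o s a x a_s; rewrite /GRing.scale /= mulrC.
exists W, w; split; last first.
  move=> cw; have : (i (c *: w) : dual_ring) 1 = 0 by rewrite cw linear0.
  by rewrite linearZ /= wE /= mul1r; exact/eqP.
have iK a x : a \in s -> a *: i x = 0.
  by move=> ats; have /(iW _).2 : exists z, i z = i x by [exists x]; exact.
split=> [a x ats | A B j g jg].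
  by apply: iinj; rewrite linearZ /= iK // linear0.
have [g' g'E] : exists g' : {linear A -> dual_ring}, g' =1 i \o g.
  by apply: linear_map => a x y; exact: (linearP (i \o g)).
have [a sja|k [kj ks]] := injective_extend_killed (s := s) (j := j) (g := g') dual_ring_injective.
  by rewrite g'E /= jg // linear0.
have /choice[l lE] b : exists z, i z = k b by apply/iW => a; exact: ks.
have [k' k'E] : exists k' : {linear B -> W}, k' =1 l.
  by apply: linear_map => a x y; apply: iinj; rewrite linearP !lE linearP.
by exists k' => a; apply: iinj; rewrite k'E lE kj g'E.
Qed.

End LinearMaps.

(** * Syzygies and regular sequences *)

Section Syzygies.
Variables (R : comNzRingType).
Implicit Types V A B C : lmodType R.

Lemma coord_linear n (l : 'I_n) :
  exists f : {linear 'rV[R]_n -> R^o}, forall v, f v = v 0 l.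
Proof. by apply: (@linear_map _ _ R^o) => a u v; rewrite !mxE. Qed.

Lemma zero_linear A B : exists f : {linear A -> B}, forall x, f x = 0.
Proof. by apply: linear_map => a u v; rewrite scaler0 addr0. Qed.

Lemma scale_linear V (v : V) : exists f : {linear R^o -> V}, forall r, f r = r *: v.
Proof.
by apply: (@linear_map _ R^o) => a x y; rewrite scalerDl -scalerA.
Qed.

Lemma row_linear V n (e : 'I_n -> V) :
  exists f : {linear 'rV[R]_n -> V}, forall v, f v = \sum_l v 0 l *: e l.
Proof.
apply: linear_map => a u v; rewrite scaler_sumr -big_split /=.
by apply: eq_bigr => l _; rewrite !mxE scalerDl scalerA.
Qed.

Lemma linear_row V n (f : {linear 'rV[R]_n -> V}) v :
  f v = \sum_l v 0 l *: f (delta_mx 0 l).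
Proof. by rewrite {1}[v]row_sum_delta linear_sum; apply: eq_bigr => l _; rewrite linearZ. Qed.

Lemma fingen_row n : fingen 'rV[R]_n.
Proof.
by exists n; exists (fun l => delta_mx 0 l) => v; exists (fun l => v 0 l);
  exact: row_sum_delta.
Qed.

Lemma fingen_cover V : fingen V ->
  exists n (p : {linear 'rV[R]_n -> V}), forall y, exists x, p x = y.
Proof.
move=> [n [e eV]]; have [p pE] := row_linear e; exists n, p => y.
have [a ->] := eV y; exists (\row_l a l); rewrite pE.
by apply: eq_bigr => l _; rewrite mxE.
Qed.

Lemma free_lift A B n (q : {linear A -> B}) (g : {linear 'rV[R]_n -> B}) (S : set A) :
  submodule S -> (forall v, exists a, S a /\ q a = g v) ->
  exists h : {linear 'rV[R]_n -> A}, (forall v, q (h v) = g v) /\ forall v, S (h v).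
Proof.
move=> sS qg; have /choice[e eP] l := qg (delta_mx 0 l).
have [h hE] := row_linear e; exists h; split=> v; rewrite hE.
  rewrite linear_sum (linear_row g); apply: eq_bigr => l _.
  by rewrite linearZ; have [_ ->] := eP l.
by apply: (submodule_sum sS) => l _; apply: (submoduleZ sS); have [] := eP l.
Qed.

Lemma regular_seq_mod_rcons V (s : seq R) a :
  regular_seq_mod [set 0 : V] (rcons s a) <->
  regular_seq_mod [set 0 : V] s /\ regular_mod (s ** V) a.
Proof.
rewrite -cats1; split=> [/regular_seq_mod_cat[? []] // | [sreg areg]].
exact/regular_seq_mod_cat.
Qed.

Lemma smul_row (s : seq R) n (v : 'rV[R]_n) :
  (s ** 'rV[R]_n) v <-> forall l, (s ** R^o) (v 0 l).
Proof.
split=> [sv l | sv].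
  by have [f fE] := coord_linear l; rewrite -fE; exact: smul_map.
rewrite [v]row_sum_delta; apply: (submodule_sum (smul_submodule _ _)) => l _.
have [f fE] := scale_linear (delta_mx 0 l : 'rV[R]_n).
by rewrite -fE; exact: smul_map.
Qed.

Lemma regular_seq_row (s : seq R) n :
  regular_seq_mod [set 0 : R^o] s -> regular_seq_mod [set 0 : 'rV[R]_n] s.
Proof.
elim/last_ind: s => // s a ih /regular_seq_mod_rcons[sreg areg].
apply/regular_seq_mod_rcons; split; first exact: ih.
move=> v /smul_row sav; apply/smul_row => l; apply: areg.
by have := sav l; rewrite mxE.
Qed.

Definition short_exact A B C (i : {linear A -> B}) (p : {linear B -> C}) : Prop :=
  [/\ forall y, exists x, p x = y, injective i
    & forall x, p x = 0 <-> exists z, i z = x].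

Lemma smul_lift B C (p : {linear B -> C}) s c :
  (forall y, exists x, p x = y) -> (s ** C) c -> exists2 b, (s ** B) b & p b = c.
Proof.
move=> psurj; have sB := smul_submodule B s.
apply: (@smul_sub _ _ [set c | exists2 b, (s ** B) b & p b = c]).
  split; first by exists 0; [exact: sB.1 | rewrite linear0].
  move=> a _ _ [x sx <-] [y sy <-]; exists (a *: x + y); last by rewrite linearP.
  exact: sB.2.
move=> a v a_s; have [b <-] := psurj v; exists (a *: b); last by rewrite linearZ.
exact: smul_mem.
Qed.

(** A sequence regular on [B] and on [C] has no higher Koszul homology on [C],
    so that [0 -> A / s A -> B / s B -> C / s C -> 0] stays exact. *)
Lemma regular_seq_kernel A B C (i : {linear A -> B}) (p : {linear B -> C}) s :
  short_exact i p -> regular_seq_mod [set 0 : B] s -> regular_seq_mod [set 0 : C] s ->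
  regular_seq_mod [set 0 : A] s /\ forall a, (s ** B) (i a) -> (s ** A) a.
Proof.
move=> [psurj iinj ip]; elim/last_ind: s => [_ _|s x ih].
  by split=> // a ia0; apply: iinj; rewrite linear0.
move=> /regular_seq_mod_rcons[sB xB] /regular_seq_mod_rcons[sC xC].
have [sA iA] := ih sB sC.
have pi a : p (i a) = 0 by apply/ip; exists a.
split.
  apply/regular_seq_mod_rcons; split=> // a sxa; apply: iA; apply: xB.
  by rewrite -linearZ; exact: smul_map.
move=> a; rewrite !add_muls_rcons => -[b [f [sb iaE]]].
have spf : (s ** C) (p f).
  apply: xC; have := pi a; rewrite iaE linearD linearZ /= => /eqP.
  rewrite addrC addr_eq0 => /eqP ->; apply: (submoduleN (smul_submodule _ _)).
  exact: smul_map.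
have [f' sf' pf'] := smul_lift psurj spf.
have [a' ia'] : exists a', i a' = f - f'.
  by apply/ip; rewrite linearB /= pf' subrr.
exists (a - x *: a'), a'; split; last by rewrite subrK.
apply: iA; rewrite linearB linearZ /= iaE ia' scalerBr opprB -addrA [x *: f + _]addrC subrK.
apply: (submoduleD (smul_submodule _ _)) => //.
exact: (submoduleZ (smul_submodule _ _)).
Qed.

End Syzygies.

(** * Complexes of injectives annihilated by a regular sequence *)

Section InjectiveComplex.
Variables (R : comNzRingType) (m : set R) (s : seq R) (c : R).
Hypotheses (R_noeth : noetherian_ring R) (R_local : local_ring m).
Implicit Types A B : lmodType R.

Variables (E : nat -> lmodType R) (d : forall k, {linear E k -> E k.+1}) (n : nat).
Hypotheses (E_inj : forall k, injective_module (E k))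
  (E_bounded : forall k (x : E k), (n < k)%N -> x = 0)
  (d_exact : forall k x, d k.+1 x = 0 <-> exists z, d k z = x).

(** The cycles of [Hom(R / (t), E)], as elements of [E]. *)
Definition killed_cycle (t : seq R) k (x : E k) : Prop :=
  d k x = 0 /\ forall a, a \in t -> a *: x = 0.

Lemma killed_cycle_submodule t k : submodule (@killed_cycle t k).
Proof.
exact: submoduleI (ker_submodule (d k)) (killed_submodule (E k) t).
Qed.

Lemma killed_divisible t a k (w : E k) : regular_mod (t ** R^o) a ->
  (forall b, b \in t -> b *: w = 0) ->
  exists w', a *: w' = w /\ forall b, b \in t -> b *: w' = 0.
Proof.
move=> areg tw; have [j jE] := scale_linear (a : R^o).
have [g gE] := scale_linear w.
have [r|h [hj ht]] := injective_extend_killed (s := t) (j := j) (g := g) (E_inj (k := k)).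
  rewrite jE => tra; have tr : (t ** R^o) r.
    by apply: areg; rewrite /GRing.scale /= mulrC.
  apply: smul_killed tr => b x bt; rewrite gE scalerA mulrC -scalerA tw //.
  by rewrite scaler0.
exists (h 1); split=> [|b bt]; last exact: ht.
by rewrite -linearZ -[w]scale1r -gE -hj jE /GRing.scale /= mulr1 mul1r.
Qed.

(** The vanishing of [Ext(R / (t), -)] in degrees above the length of [t]: if
    [y] is a lift of [z] that only the last entry [a] of [t] fails to kill, then
    [a y] is a boundary [d (a w')], and [y - d w'] is a better lift. *)
Lemma killed_exact t k (z : E k.+1) : regular_seq_mod [set 0 : R^o] t ->
  (size t <= k)%N -> killed_cycle t z ->
  exists y : E k, d k y = z /\ forall b, b \in t -> b *: y = 0.
Proof.
elim/last_ind: t k z => [|t a ih] k z.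
  by move=> _ _ [/(d_exact (k := k))[y yz] _]; exists y.
move=> /regular_seq_mod_rcons[treg areg]; rewrite size_rcons.
case: k z => // k z; rewrite ltnS => tk [dz tz].
have tz' b : b \in t -> b *: z = 0.
  by move=> bt; apply: tz; rewrite mem_rcons inE bt orbT.
have [y [dy ty]] := ih k.+1 z treg (leqW tk) (conj dz tz').
have [|w [dw tw]] := ih k (a *: y) treg tk.
  split; first by rewrite linearZ /= dy tz // mem_rcons mem_head.
  by move=> b bt; rewrite scalerA mulrC -scalerA ty // scaler0.
have [w' [aw' tw']] := killed_divisible areg tw.
have dd : d k.+1 (d k w') = 0 by apply/d_exact; exists w'.
exists (y - d k w'); split; first by rewrite linearB /= dy dd subr0.
move=> b; rewrite mem_rcons inE => /orP[/eqP -> | bt].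
  by rewrite scalerBr -linearZ aw' dw subrr.
by rewrite scalerBr ty // -linearZ tw' // linear0 subr0.
Qed.

Hypotheses (s_reg : regular_seq_mod [set 0 : R^o] s)
  (s_socle : forall (V : lmodType R) (U : set V), submodule U -> U <> setT -> s ** V `<=` U ->
     has_socle m U)
  (c_nonzero : ~ (s ** R^o) c) (c_socle : forall r, m r -> (s ** R^o) (r * c)).

Lemma socle_unit r : ~ m r -> ~ (s ** R^o) (r * c).
Proof.
move=> /(local_unit R_noeth R_local)[b br] src; apply: c_nonzero.
rewrite -[c]mul1r -br -mulrA.
exact: (submoduleZ (smul_submodule R^o s)) src.
Qed.

(** The cycles of degree [k] of [Hom(R / (s), E)] are injective over [R / (s)],
    for maps into Noetherian modules. *)
Definition cycles_injective k : Prop :=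
  forall A B (j : {linear A -> B}) (g : {linear A -> E k}),
    noetherian_module B -> (forall x, (s ** B) (j x) -> g x = 0) ->
    (forall x, killed_cycle s (g x)) ->
    exists h : {linear B -> E k}, (forall x, h (j x) = g x) /\
      forall b, killed_cycle s (h b).

(** The socle of the cycles in degree [k.+1] lifts to the socle in degree [k]:
    being injective, those cycles [v] are multiples [c *: v'], and [c] times
    any lift of [v'] is annihilated by [m]. *)
Lemma lift_socle k (v : E k.+1) : (size s <= k)%N -> cycles_injective k.+1 ->
  killed_cycle s v -> (forall r, m r -> r *: v = 0) ->
  exists y : E k, [/\ d k y = v, forall b, b \in s -> b *: y = 0
    & forall r, m r -> r *: y = 0].
Proof.
move=> sk Ik [dv sv] mv.
have [j jE] := scale_linear (c : R^o); have [g gE] := scale_linear v.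
have [||r|h [hj hcyc]] := Ik _ _ j g.
- by apply: fingen_noetherian => //; exact: fingen_regular.
- move=> r; rewrite jE gE => src; apply: mv; apply: contrapT => mr.
  exact: (socle_unit mr).
- rewrite gE; split; first by rewrite linearZ /= dv scaler0.
  by move=> b bs; rewrite scalerA mulrC -scalerA sv // scaler0.
have [y [dy sy]] := killed_exact s_reg sk (hcyc 1).
exists (c *: y); split.
- by rewrite linearZ /= dy -linearZ -[v]scale1r -gE -hj jE /GRing.scale /= mulr1 mul1r.
- by move=> b bs; rewrite scalerA mulrC -scalerA sy // scaler0.
- move=> r mr; rewrite scalerA; have [f fE] := scale_linear y.
  rewrite -fE; apply: smul_killed (c_socle mr) => b x bs.
  by rewrite fE scalerA mulrC -scalerA sy // scaler0.
Qed.

(** Extend [g] to a map [h0] into [E k]; its boundary has to be corrected by a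
    map into [E k] that vanishes on the image of [j].  The correction is built
    on larger and larger submodules [S] of [B], one socle element modulo [S]
    at a time. *)
Lemma cycles_injective_step k : (size s <= k)%N ->
  cycles_injective k.+1 -> cycles_injective k.
Proof.
move=> sk Ik A B j g Bn jg gcyc.
have [h0 [h0j h0s]] := injective_extend_killed (E_inj (k := k)) jg.
suff [y [ys yj yd]] : exists y : {linear B -> E k},
    [/\ forall b x, b \in s -> b *: y x = 0, forall a, y (j a) = 0
      & forall x, d k (y x) = d k (h0 x)].
  have [h hE] : exists h : {linear B -> E k}, forall x, h x = h0 x - y x.
    apply: linear_map => a u v; rewrite (linearP h0) (linearP y).
    by rewrite opprD addrACA scalerBr.
  exists h; split=> [a|b]; first by rewrite hE h0j yj subr0.
  rewrite hE; split; first by rewrite linearB /= yd subrr.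
  by move=> a a_s; rewrite scalerBr h0s // ys // subr0.
pose F : set (set B) := [set S | [/\ submodule S, s ** B `<=` S, range j `<=` S &
  exists y : {linear B -> E k}, [/\ forall b x, b \in s -> b *: y x = 0,
     forall a, y (j a) = 0 & forall x, S x -> d k (y x) = d k (h0 x)]]].
pose S0 : set B := [set x | d k (h0 x) = 0].
have FS S : F S -> submodule S by case.
have FS0 : F S0.
  split.
  - exact: preimage_submodule (ker_submodule (d k)).
  - apply: smul_sub; first exact: preimage_submodule (ker_submodule (d k)).
    by move=> a v a_s; rewrite /S0 /= linearZ /= h0s // linear0.
  - by move=> _ [a _ <-]; rewrite /S0 /= h0j; case: (gcyc a).
  - have [z zE] := zero_linear B (E k).
    exists z; split=> [b x _|a|x Sx]; rewrite !zE ?scaler0 //.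
    by rewrite linear0.
have [S [[sS sBS jS [y [ys yj yd]]] _ maxS]] := maximal_submodule Bn FS FS0.
have [ST | ST] := pselect (S = setT); first by exists y; split=> // x; apply: yd; rewrite ST.
exfalso; have [v [Sv mv]] := s_socle sS ST sBS.
have [e eE] : exists e : {linear B -> E k}, forall x, e x = h0 x - y x.
  apply: linear_map => a u w; rewrite (linearP h0) (linearP y).
  by rewrite opprD addrACA scalerBr.
have es b x : b \in s -> b *: e x = 0.
  by move=> bs; rewrite eE scalerBr h0s // ys // subr0.
have vcyc : killed_cycle s (d k (e v)).
  split; first by apply/d_exact; exists (e v).
  by move=> b bs; rewrite -linearZ es // linear0.
have [r mr|z [dz sz mz]] := lift_socle sk Ik vcyc.
  have rv : r *: e v = e (r *: v) by rewrite linearZ.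
  by rewrite -linearZ rv eE linearB /= yd ?subrr //; exact: mv.
have [U [i [iinj iU]]] := submodule_type sS.
have [j' j'E] : exists j' : {linear (U * R^o)%type -> B},
    forall u : (U * R^o)%type, j' u = i u.1 + (u.2 : R) *: v.
  apply: linear_map => a u w /=.
  by rewrite linearP scalerDl scalerDr scalerA addrACA.
have [g' g'E] : exists g' : {linear (U * R^o)%type -> E k},
    forall u : (U * R^o)%type, g' u = (u.2 : R) *: z.
  by apply: linear_map => a u w /=; rewrite scalerDl scalerA.
have [[u r]|y' [y'j' y's]] := injective_extend_killed (s := s) (j := j') (g := g') (E_inj (k := k)).
  rewrite j'E g'E /= => /sBS Siurv; apply: mz; apply: contrapT => mr.
  have Siu : S (i u) by apply/iU; exists u.
  have /(local_unit R_noeth R_local)[b br] := mr.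
  apply: Sv; rewrite -[v]scale1r -br -scalerA; apply: (submoduleZ sS).
  exact: (submodule_addl sS Siu).
have y'S x : S x -> y' x = 0.
  move=> /iU[u <-]; have := y'j' (u, 0).
  by rewrite j'E g'E /= !scale0r addr0.
have y'v : y' v = z.
  by have := y'j' (0, 1); rewrite j'E g'E /= !scale1r linear0 add0r.
have [w wE] : exists w : {linear B -> E k}, forall x, w x = y x + y' x.
  by apply: linear_map => a x x'; rewrite (linearP y) (linearP y') scalerDr addrACA.
pose S' : set B := [set x | d k (w x) = d k (h0 x)].
have SS' : S `<=` S' by move=> x Sx; rewrite /S' /= wE y'S // addr0; exact: yd.
suff S'S : S' = S.
  apply: Sv; rewrite -S'S /S' /= wE y'v linearD /= dz eE linearB /=.
  by rewrite addrC subrK.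
apply: maxS => //; split.
- split; first by rewrite /S' /= !linear0.
  by move=> a x x'; rewrite /S' /= !linearP => -> ->.
- exact: subset_trans sBS SS'.
- exact: subset_trans jS SS'.
- exists w; split=> // [b x bs | a]; rewrite wE.
    by rewrite scalerDr ys // y's // addr0.
  by rewrite yj y'S ?addr0 //; apply: jS; exists a.
Qed.

(** Descending induction from degrees where [E] vanishes. *)
Lemma cycles_injective_ge k : (size s <= k)%N -> cycles_injective k.
Proof.
have base N : (n < N)%N -> cycles_injective N.
  move=> nN A B j g _ _ _.
  have [z zE] := zero_linear B (E N).
  exists z; split=> [x|b]; first by rewrite zE [RHS]E_bounded.
  by rewrite zE; exact: (killed_cycle_submodule s N).1.
have {}base i : forall k, (n < k + i)%N -> (size s <= k)%N -> cycles_injective k.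
  elim: i => [|i ih] {}k; first by rewrite addn0 => /base.
  rewrite addnS -addSn => nki sk; apply: cycles_injective_step => //.
  by apply: ih => //; exact: leqW.
by apply: (base n.+1 k); rewrite addnS ltnS leq_addl.
Qed.

(** [m S], as the smallest submodule containing the products. *)
Definition ideal_mul A (S : set A) : set A :=
  [set x | forall Q : set A, submodule Q ->
    (forall r q, m r -> S q -> Q (r *: q)) -> Q x].

Lemma ideal_mul_submodule A (S : set A) : submodule (ideal_mul S).
Proof.
split=> [Q sQ _|a x y mx my Q sQ SQ]; first exact: sQ.1.
by apply: sQ.2; [exact: mx | exact: my].
Qed.

Lemma ideal_mul_mem A (S : set A) r q : m r -> S q -> ideal_mul S (r *: q).
Proof. by move=> mr Sq Q _; exact. Qed.

(** Descent along [t], the part of [s] that is not in [u].  With [a] the head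
    of [t], the map [v] below solves [v (a z) = f z], and its boundary is a map
    of the same kind as [f], one degree higher and modulo [a].  A lift [y] of
    an approximate extension of that boundary gives the approximate extension
    [a y] of [f]. *)
Lemma extend_modulo u t k A r (i : {linear A -> 'rV[R]_r}) (f : {linear A -> E k}) :
  s = u ++ t -> size u = k -> [set` s] `<=` m ->
  regular_seq_mod [set 0 : A] s -> (forall a, (s ** 'rV[R]_r) (i a) -> (s ** A) a) ->
  (forall a, killed_cycle u (f a)) ->
  exists h : {linear 'rV[R]_r -> E k}, (forall v, killed_cycle u (h v)) /\
    forall a, ideal_mul (@killed_cycle u k) (h (i a) - f a).
Proof.
move=> + + sm sA iA; elim: t u k f => [|a t ih] u k f.
  rewrite cats0 => <- uk fcyc.
  have sk : (size s <= k)%N by rewrite uk.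
  have [||h [hi hcyc]] := cycles_injective_ge sk (j := i) (g := f) _ _ fcyc.
  - by apply: fingen_noetherian => //; exact: fingen_row.
  - by move=> x /iA sx; apply: smul_killed sx => b y bs; case: (fcyc y) => _; exact.
  - exists h; split=> // x; rewrite hi subrr.
    exact: (ideal_mul_submodule _).1.
rewrite -cat_rcons => sE uk fcyc.
have ma : m a by apply: sm; rewrite /= sE mem_cat mem_rcons mem_head.
have /regular_seq_mod_cat[/regular_seq_mod_rcons[ureg _] _] :
  regular_seq_mod [set 0 : R^o] (rcons u a ++ t) by rewrite -sE.
have /regular_seq_mod_cat[/regular_seq_mod_rcons[_ aA] _] :
  regular_seq_mod [set 0 : A] (rcons u a ++ t) by rewrite -sE.
have [mul mulE] : exists mul : {linear A -> A}, forall x, mul x = a *: x.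
  by apply: linear_map => b x y; rewrite scalerDr !scalerA mulrC.
have fu x : (u ** A) x -> f x = 0.
  by move=> ux; apply: smul_killed ux => b y bu; case: (fcyc y) => _; exact.
have [x|v [va vu]] := injective_extend_killed (s := u) (j := mul) (g := f) (E_inj (k := k)).
  by rewrite mulE => /aA; exact: fu.
have [f' f'E] : exists f' : {linear A -> E k.+1}, forall x, f' x = d k (v x).
  by apply: linear_map => b x y; rewrite !linearP.
have f'cyc x : killed_cycle (rcons u a) (f' x).
  rewrite f'E; split; first by apply/d_exact; exists (v x).
  move=> b; rewrite mem_rcons inE => /orP[/eqP -> | bu].
    by rewrite -!linearZ -mulE va; case: (fcyc x).
  by rewrite -linearZ vu // linear0.
have [|h' [h'cyc h'f']] := ih (rcons u a) k.+1 f' sE _ f'cyc.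
  by rewrite size_rcons uk.
have uk' : (size u <= k)%N by rewrite uk.
have lift_cycle (q : E k.+1) : killed_cycle (rcons u a) q ->
    exists z, (forall b, b \in u -> b *: z = 0) /\ d k z = q.
  move=> [dq qu]; have [|z [dz zu]] := killed_exact ureg uk' (z := q); last by exists z.
  by split=> // b bu; apply: qu; rewrite mem_rcons inE bu orbT.
have [y [dy yu]] := free_lift (killed_submodule (E k) u) (fun v => lift_cycle _ (h'cyc v)).
have [h hE] : exists h : {linear 'rV[R]_r -> E k}, forall x, h x = a *: y x.
  by apply: linear_map => b x z; rewrite linearP scalerDr !scalerA mulrC.
have acyc z : (forall b, b \in u -> b *: z = 0) ->
    killed_cycle (rcons u a) (d k z) -> killed_cycle u (a *: z).
  move=> zu [_ dzu]; split.
    by rewrite linearZ /= dzu // mem_rcons mem_head.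
  by move=> b bu; rewrite scalerA mulrC -scalerA zu // scaler0.
exists h; split=> [x | x].
  by rewrite hE; apply: acyc; [exact: yu | rewrite dy; exact: h'cyc].
pose Q : set (E k.+1) := [set q | exists z, [/\ d k z = q,
  (forall b, b \in u -> b *: z = 0) & ideal_mul (@killed_cycle u k) (a *: z)]].
have [|b q mb qcyc|z [dz zu mz]] := h'f' x Q.
- split.
    exists 0; split=> [|b _|]; rewrite ?linear0 ?scaler0 //.
    exact: (ideal_mul_submodule _).1.
  move=> b _ _ [z [<- zu mz]] [w [<- wu mw]]; exists (b *: z + w).
  split=> [|c' c'u|]; first by rewrite linearP.
    exact: (killed_submodule (E k) u).2 zu wu _ c'u.
  by rewrite scalerDr scalerA mulrC -scalerA; apply: (ideal_mul_submodule _).2.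
- have [z [zu dz]] := lift_cycle q qcyc; exists (b *: z); split.
  + by rewrite linearZ /= dz.
  + by move=> e eu; rewrite scalerA mulrC -scalerA zu // scaler0.
  + rewrite scalerA mulrC -scalerA; apply: ideal_mul_mem => //.
    by apply: acyc => //; rewrite dz.
have -> : h (i x) - f x = a *: (y (i x) - v x - z) + a *: z.
  rewrite -scalerDr subrK scalerBr hE; congr (_ - _).
  by rewrite -linearZ -mulE va.
apply: (submoduleD (ideal_mul_submodule _)) => //.
apply: ideal_mul_mem => //; split.
  by rewrite !linearB /= dy dz -f'E subrr.
move=> b bu; rewrite !scalerBr vu // zu // !subr0.
exact: yu.
Qed.

End InjectiveComplex.

(** * Residue functionals *)

Section Residue.
Variables (R : comNzRingType) (m : set R).
Hypotheses (R_noeth : noetherian_ring R) (R_local : local_ring m).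
Implicit Types V W X M N : lmodType R.

(** A nonzero linear map from [V] to the residue field, lifted to [R]. *)
Definition residue_functional V (f : V -> R) : Prop :=
  (forall a x y, m (f (a *: x + y) - (a * f x + f y))) /\ exists x, ~ m (f x).

Lemma residue_scale V W (f : V -> R) (w : W) : residue_functional f ->
  (forall r, m r -> r *: w = 0) ->
  exists h : {linear V -> W}, forall x, h x = f x *: w.
Proof.
move=> [flin _] mw; apply: linear_map => a x y; apply/subr0_eq.
rewrite scalerA -scalerDl -scalerBl; exact: mw.
Qed.

Lemma exists_residue_functional V : fingen V -> (exists x : V, x <> 0) ->
  exists f, @residue_functional V f.
Proof.
move=> Vfg [x xn0]; have Vn := fingen_noetherian R_noeth Vfg.
have [||Y [x0 [sY _ [_ Yx0] gen mY]]] := nakayama_maximal R_noeth R_local Vn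
  (submodule0 V) (submoduleT V).
- by [].
- by move/(_ x I).
have /choice[f fP] y : exists r, Y (y - r *: x0) by exact: gen.
exists f; split.
  move=> a y z; set r := _ - _; apply: contrapT => mr.
  have [b br] := local_unit R_noeth R_local mr; apply: Yx0.
  rewrite -[x0]scale1r -br -scalerA; apply: (submoduleZ sY).
  have -> : r *: x0 = (a *: (y - f y *: x0) + (z - f z *: x0))
      - ((a *: y + z) - f (a *: y + z) *: x0).
    rewrite [a *: (_ - _)]scalerBr [X in X - _]addrACA -opprD.
    by rewrite opprB [RHS]addrC addrA subrK /r scalerBl scalerDl -scalerA.
  by apply: (submoduleB sY) => //; apply: sY.2.
exists x0 => mfx; apply: Yx0; rewrite -(subrK (f x0 *: x0) x0).
by apply: (submoduleD sY) => //; exact: mY.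
Qed.

Lemma residue_functional_submodule V (f : V -> R) :
  residue_functional f -> submodule [set x | m (f x)].
Proof.
have sm := maximal_ideal_submodule R_local.
move=> [flin _]; split=> [|a x y mx my] /=.
  have := flin (-1) 0 0; rewrite scaler0 addr0 mulN1r addNr subr0.
  by [].
rewrite -(subrK (a * f x + f y) (f (a *: x + y))).
by apply: (submoduleD sm) => //; apply: sm.2.
Qed.

(** The product of [f] and [g] factors through the tensor product of the residue
    fields.  Scaling by [w], which [m] kills, makes it a bilinear map with
    values in [W], from which [h] is read off. *)
Lemma residue_functional_tensor M N W (w : W) (f : M -> R) (g : N -> R) :
  residue_functional f -> residue_functional g ->
  (forall r, m r -> r *: w = 0) -> w <> 0 ->
  exists h, @residue_functional (tensor M N) h.
Proof.
move=> fres gres mw wn0; have [flin [x mfx]] := fres; have [glin [y mgy]] := gres.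
have mw' r : m r -> forall a, (a * r) *: w = 0.
  by move=> mr a; apply: mw; exact: maximal_idealMl R_local _ _ mr.
have [b bE] : exists b : {bilinear M -> N -> W}, forall u v, b u v = (f u * g v) *: w.
  apply: bilinear_map => [v a u u' | u a v v'].
    apply/subr0_eq; rewrite scalerA -scalerDl -scalerBl mulrA -mulrDl -mulrBl mulrC.
    exact: mw'.
  apply/subr0_eq; rewrite scalerA -scalerDl -scalerBl mulrCA -mulrDr -mulrBr.
  exact: mw'.
have [th thE] := tensor_lift b.
have /choice[h hP] u : exists r, th u = r *: w.
  have [s ->] := tensor_sum_tens u; rewrite linear_sum.
  elim: s => [|p s [r rE]]; first by exists 0; rewrite big_nil scale0r.
  exists (f p.1 * g p.2 + r); rewrite big_cons rE thE bE.
  by rewrite scalerDl.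
have wm r : r *: w = 0 -> m r.
  move=> rw; apply: contrapT => /(local_unit R_noeth R_local)[c cr]; apply: wn0.
  by rewrite -[w]scale1r -cr -scalerA rw scaler0.
exists h; split=> [a u v|].
  by apply: wm; rewrite scalerBl scalerDl -scalerA -!hP linearP subrr.
exists (tens x y) => mh.
have [c cf] := local_unit R_noeth R_local mfx.
have [e eg] := local_unit R_noeth R_local mgy.
have : (c * e) *: th (tens x y) = w by rewrite thE bE scalerA mulrACA cf eg mulr1 scale1r.
by rewrite hP mw // scaler0 => /esym.
Qed.

End Residue.

(** * Projective resolutions tensored with a module injective over [R / (s)] *)

Section ProjectiveTensor.
Variables (R : comNzRingType).
Implicit Types V A B C X Y P K W : lmodType R.

(** Split the projection onto [P] of the free module on the set [P], and keep
    the finitely many coordinates that occur in the given elements. *)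
Lemma finite_dual_basis P (ps : seq P) : projective P ->
  exists n (q : 'I_n -> P) (c : 'I_n -> {linear P -> R^o}),
    forall p, p \in ps -> \sum_l c l p *: q l = p.
Proof.
move=> Pproj.
have liftB := @lift_is_additive R P P id.
have lift0 : fglift (@id P) (0 : {freeg P / R}) = 0 by rewrite -(subrr 0) liftB subrr.
have liftN D : fglift (@id P) (- D : {freeg P / R}) = - fglift (@id P) D.
  by rewrite -[- D]sub0r liftB lift0 sub0r.
have liftD (D D' : {freeg P / R}) :
    fglift (@id P) (D + D') = fglift (@id P) D + fglift (@id P) D'.
  by rewrite -[D' in LHS]opprK liftB liftN opprK.
have lift_sum (r : seq P) (F : P -> {freeg P / R}) :
    fglift (@id P) (\sum_(x <- r) F x) = \sum_(x <- r) fglift (@id P) (F x).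
  exact: (big_morph _ liftD lift0).
have liftE (D : {freeg P / R}) : fglift (@id P) D = \sum_(x <- dom D) coeff x D *: x.
  by rewrite -{1}(freeg_sumE D) lift_sum; apply: eq_bigr => x _; rewrite liftU.
have [ev evE] : exists ev : {linear {freeg P / R} -> P}, ev =1 fglift (@id P).
  apply: linear_map => a D D'; rewrite liftD; congr (_ + _).
  rewrite [a *: D]/(fgscale a D) /fgscale lift_sum liftE scaler_sumr.
  by apply: eq_bigr => x _; rewrite liftU scalerA.
have [|h hE] := Pproj _ _ ev (idfun : {linear P -> P}).
  by move=> p; exists << p >>; rewrite evE liftU scale1r.
pose qs := undup (flatten [seq dom (h p) | p <- ps]).
have /choice[c cE] (l : 'I_(size qs)) :
    exists c : {linear P -> R^o}, forall p, c p = coeff qs`_l (h p).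
  by apply: (@linear_map _ P R^o) => a x y; rewrite linearP coeffD coeffZ.
exists (size qs), (fun l => qs`_l), c => p pps.
rewrite -[RHS](hE p) evE liftE.
transitivity (\sum_(x <- qs) coeff x (h p) *: x).
  rewrite (big_nth 0) big_mkord; apply: eq_bigr => l _; by rewrite cE.
rewrite (bigID (mem (dom (h p)))) /= [X in _ + X]big1 ?addr0; last first.
  by move=> x xd; rewrite coeff_outdom // scale0r.
rewrite -big_filter; apply: perm_big; apply: uniq_perm.
- by apply: filter_uniq; exact: undup_uniq.
- exact: uniq_dom.
move=> x; rewrite mem_filter mem_undup andb_idr // => xd.
by apply/flattenP; exists (dom (h p)) => //; apply/mapP; exists p.
Qed.

Lemma tensor_map X Y W (f : {linear X -> Y}) :
  exists h : {linear tensor X W -> tensor Y W},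
    forall x w, h (tens x w) = tens (f x) w.
Proof.
have [b bE] : exists b : {bilinear X -> W -> tensor Y W}, forall x w, b x w = tens (f x) w.
  apply: bilinear_map => [w a x x' | x a w w']; first by rewrite linearP linearPl.
  by rewrite linearPr.
by have [h hE] := tensor_lift b; exists h => x w; rewrite hE bE.
Qed.

Lemma tensor_functional X W (c : {linear X -> R^o}) :
  exists h : {linear tensor X W -> W}, forall x w, h (tens x w) = (c x : R) *: w.
Proof.
have [b bE] : exists b : {bilinear X -> W -> W}, forall x w, b x w = (c x : R) *: w.
  apply: bilinear_map => [w a x x' | x a w w'].
    by rewrite linearP scalerDl -scalerA.
  by rewrite scalerDr !scalerA mulrC.
by have [h hE] := tensor_lift b; exists h => x w; rewrite hE bE.
Qed.

Variable s : seq R.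

(** [P (x) W] is a summand of a direct sum of copies of [W], and the image of a
    finitely generated module only meets finitely many of them. *)
Lemma projective_tensor_extend P W A B (j : {linear A -> B})
    (f : {linear A -> tensor P W}) :
  projective P -> seq_injective s W -> fingen A ->
  (forall a, (s ** B) (j a) -> (s ** A) a) ->
  exists h : {linear B -> tensor P W}, forall a, h (j a) = f a.
Proof.
move=> Pproj [Wkill Winj] /fingenP[es eT] js.
have [ps psP] : exists ps : seq P, forall e, e \in es ->
    exists us : seq (P * W), (forall u, u \in us -> u.1 \in ps) /\
      f e = \sum_(u <- us) tens u.1 u.2.
  elim: (es) => [|e es' [ps psP]]; first by exists [::].
  have [us feE] := tensor_sum_tens (f e).
  exists ([seq u.1 | u <- us] ++ ps) => e'; rewrite inE => /orP[/eqP -> | /psP].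
    by exists us; split=> // u uus; rewrite mem_cat map_f.
  move=> [us' [us'P ->]]; exists us'; split=> // u /us'P ups.
  by rewrite mem_cat ups orbT.
have [n [q [c qc]]] := finite_dual_basis ps Pproj.
have /choice[b bE] l := tensor_functional W (c l).
have /choice[h hE] l : exists h : {linear B -> W}, forall a, h (j a) = b l (f a).
  have [g gE] : exists g : {linear A -> W}, forall a, g a = b l (f a).
    by apply: linear_map => a x y; rewrite !linearP.
  have [a /js sa|h hj] := Winj _ _ j g; last by exists h => a; rewrite hj gE.
  by apply: smul_killed sa => d x ds; exact: Wkill.
have [H HE] : exists H : {linear B -> tensor P W}, forall x, H x = \sum_l tens (q l) (h l x).
  apply: linear_map => a x y; rewrite scaler_sumr -big_split /=.
  by apply: eq_bigr => l _; rewrite linearP linearPr.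
exists H => a.
have [K [KE Kes]] : exists K : {linear A -> tensor P W},
    (forall x, K x = H (j x) - f x) /\ forall e, e \in es -> K e = 0.
  have [K KE] : exists K : {linear A -> tensor P W}, forall x, K x = H (j x) - f x.
    apply: linear_map => r x y; rewrite (linearP j) (linearP H) (linearP f).
    by rewrite opprD addrACA scalerBr.
  exists K; split=> // e /psP[us [usP feE]].
  rewrite KE HE; apply/subr0_eq; rewrite subr0; apply/eqP; rewrite subr_eq0; apply/eqP.
  under eq_bigr => l _ do rewrite hE feE linear_sum linear_sumr.
  rewrite exchange_big feE big_seq [RHS]big_seq; apply: eq_bigr => u /usP ups.
  under eq_bigr => l _ do rewrite bE linearZr -linearZl.
  by rewrite -linear_sumlz qc.
apply/subr0_eq; rewrite -KE.
have : lspan es a by rewrite eT.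
by apply: (lspan_sub (ker_submodule K)).
Qed.

(** Projective dimension less than [n], by successive short exact sequences, so
    that dimension shifting becomes induction on [n]. *)
Fixpoint pd_le (n : nat) X : Prop :=
  if n is n'.+1 then
    exists P K (i : {linear K -> P}) (p : {linear P -> X}),
      [/\ projective P, short_exact i p & pd_le n' K]
  else forall x : X, x = 0.

Lemma projective_resolution_pd_le X n : projective_resolution X n -> exists k, pd_le k X.
Proof.
move=> [P [d [e [Pproj Pbd esurj ker_e ker_d]]]].
suff res N : forall k K (q : {linear P k -> K}), (n < N + k)%N ->
    (forall y, exists x, q x = y) -> (forall x, q x = 0 <-> exists z, d k z = x) ->
    pd_le N K.
  by exists n.+1; apply: (res n.+1 0%N X e) => //; rewrite addn0.
elim: N => [|N ih] k K q; first by move=> nk qsurj _ y; have [x <-] := qsurj y;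
  rewrite (Pbd k x) ?linear0.
rewrite addSnnS => nNk qsurj ker_q.
have [K' [i [iinj iK']]] := submodule_type (ker_submodule q).
have /choice[q0 q0E] (z : P k.+1) : exists u, i u = d k z.
  by apply/iK'; apply/ker_q; exists z.
have [q' q'E] : exists q' : {linear P k.+1 -> K'}, q' =1 q0.
  by apply: linear_map => a x y; apply: iinj; rewrite linearP !q0E linearP.
exists (P k), K', i, q; split=> //; apply: (ih k.+1 K' q') => // [u | x].
  have /ker_q[z dz] : q (i u) = 0 by apply/iK'; exists u.
  by exists z; apply: iinj; rewrite q'E q0E.
rewrite -ker_d -q0E q'E; split=> [-> | ]; first by rewrite linear0.
by move=> iq; apply: iinj; rewrite iq linear0.
Qed.

Lemma linear_factor A B C (p : {linear A -> B}) (f : {linear A -> C}) :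
  (forall y, exists x, p x = y) -> (forall x, p x = 0 -> f x = 0) ->
  exists h : {linear B -> C}, forall x, h (p x) = f x.
Proof.
move=> psurj pf; have /choice[k kE] := psurj.
have fp x y : p x = p y -> f x = f y.
  by move=> pxy; apply/subr0_eq; rewrite -linearB pf // linearB /= pxy subrr.
have [h hE] : exists h : {linear B -> C}, forall y, h y = f (k y).
  by apply: linear_map => a x y; rewrite -linearP; apply: fp; rewrite linearP !kE.
by exists h => x; rewrite hE; apply: fp.
Qed.

Hypotheses (R_noeth : noetherian_ring R) (s_reg : regular_seq_mod [set 0 : R^o] s).

Lemma fingen_injective A B (i : {linear A -> B}) :
  noetherian_module B -> injective i -> fingen A.
Proof.
move=> Bn iinj; have [gs gsE] := Bn _ (image_submodule i).
have [hs hsE] : exists hs, gs = [seq i h | h <- hs].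
  have gs_im g : g \in gs -> range i g by move=> /mem_lspan; rewrite -gsE.
  elim: (gs) gs_im => [|g gs' ih] gs_im; first by exists [::].
  have [|hs ->] := ih; first by move=> h hgs; apply: gs_im; rewrite inE hgs orbT.
  by have [h _ <-] := gs_im g (mem_head _ _); exists (h :: hs).
have lift y : lspan [seq i h | h <- hs] y -> exists2 x, lspan hs x & i x = y.
  elim: (hs) y => [y -> | h hs' ih _ [a [y [/ih[x hx <-] ->]]]].
    by exists 0; rewrite ?linear0.
  by exists (a *: h + x); [exists a, x | rewrite linearP].
apply/fingenP; exists hs; apply/seteqP; split=> // x _.
have [|x' hx' /iinj <- //] := lift (i x).
by rewrite -hsE -gsE; exists x.
Qed.

(** [f] composed with [X -> X (x) W] becomes extendable: dimension shifting
    along [0 -> K -> P -> X -> 0] and along the syzygies of [C]. *)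
Lemma pd_le_tensor_extend n X W w : seq_injective s W -> pd_le n X ->
  forall C A r (i : {linear A -> 'rV[R]_r}) (p : {linear 'rV[R]_r -> C})
    (f : {linear A -> X}),
  short_exact i p -> regular_seq_mod [set 0 : C] s ->
  exists h : {linear 'rV[R]_r -> tensor X W}, forall a, h (i a) = tens (f a) w.
Proof.
move=> Winj; elim: n X => [|n ih] X.
  move=> X0 C A r i p f _ _; have [z zE] := zero_linear 'rV[R]_r (tensor X W).
  by exists z => a; rewrite zE (X0 (f a)) linear0l.
move=> [P [K [k [q [Pproj [qsurj kinj qk] Kpd]]]]] C A r i p f ip sC.
have [psurj iinj ker_p] := ip.
have srow l := regular_seq_row l s_reg.
have [sA iA] := regular_seq_kernel ip (srow r) sC.
have Afg : fingen A.
  apply: (fingen_injective (i := i)) => //; apply: fingen_noetherian => //.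
  exact: fingen_row.
have [l [c csurj]] := fingen_cover Afg.
have [A' [i' [i'inj i'A]]] := submodule_type (ker_submodule c).
have i'c : short_exact i' c by split=> // x; exact: i'A.
have [fc fcE] : exists fc : {linear 'rV[R]_l -> X}, forall v, fc v = f (c v).
  by apply: linear_map => a x y; rewrite !linearP.
have [F [qF _]] := free_lift (submoduleT P) (q := q) (g := fc)
  (fun v => let: ex_intro x E := qsurj (fc v) in ex_intro _ x (conj I E)).
have /choice[f0 f0E] (a : A') : exists z, k z = F (i' a).
  apply/qk; rewrite qF fcE; have -> : c (i' a) = 0 by apply/i'A; exists a.
  by rewrite linear0.
have [f' f'E] : exists f' : {linear A' -> K}, f' =1 f0.
  by apply: linear_map => a x y; apply: kinj; rewrite linearP !f0E !linearP.
have [h' h'E] := ih K Kpd A A' l i' c f' i'c sA.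
have [kW kWE] := tensor_map W k; have [qW qWE] := tensor_map W q.
have qkW u : qW (kW u) = 0.
  have [qk0 qk0E] : exists qk0 : {linear tensor K W -> tensor X W},
      forall u, qk0 u = qW (kW u) by apply: linear_map => a x y; rewrite !linearP.
  have [z zE] := zero_linear (tensor K W) (tensor X W).
  rewrite -qk0E -(zE u); apply: tensor_hom_ext => x y.
  rewrite qk0E zE kWE qWE; have -> : q (k x) = 0 by apply/qk; exists x.
  by rewrite linear0l.
have [g gE] : exists g : {linear 'rV[R]_l -> tensor P W},
    forall v, g v = tens (F v) w - kW (h' v).
  apply: linear_map => a x y.
  rewrite (linearP F) (linearP h') (linearP kW) linearPl.
  by rewrite opprD addrACA scalerBr.
have [|g' g'E] := linear_factor csurj (f := g).
  move=> x /i'A[a <-]; rewrite gE h'E kWE f'E f0E subrr.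
  by [].
have [H HE] := projective_tensor_extend (j := i) g' Pproj Winj Afg iA.
have [h hE] : exists h : {linear 'rV[R]_r -> tensor X W}, forall v, h v = qW (H v).
  by apply: linear_map => a x y; rewrite !linearP.
exists h => a; have [v <-] := csurj a.
by rewrite hE HE g'E gE linearB /= qkW subr0 qWE qF fcE.
Qed.

End ProjectiveTensor.

(** * Tensor products with a syzygy *)

Section SyzygyTensor.
Variables (R : comNzRingType) (m : set R).
Hypotheses (R_noeth : noetherian_ring R) (R_local : local_ring m).
Implicit Types L M N X : lmodType R.

Lemma krull_dim_unique d e : krull_dim_is R d -> krull_dim_is R e -> d = e.
Proof.
move=> [[p pP] maxd] [[q qP] maxe]; apply/eqP; rewrite eqn_leq.
by rewrite (maxe d p pP) (maxd e q qP).
Qed.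

(** If some coordinate of a relation is a unit, the corresponding generator is
    redundant. *)
Lemma minimal_cover_kernel L n (p : {linear 'rV[R]_n -> L}) v l : mu_is L n ->
  (forall y, exists x, p x = y) -> p v = 0 -> m (v 0 l).
Proof.
move=> [_ minL] psurj pv; apply: contrapT => /(local_unit R_noeth R_local)[b bv].
pose e j : L := p (delta_mx 0 j).
pose gs := [seq e j | j <- enum [pred j | j != l]].
have sgs := lspan_submodule gs.
have egs j : lspan gs (e j).
  have ne k : k != l -> lspan gs (e k).
    by move=> kl; apply: mem_lspan; apply/mapP; exists k; rewrite // mem_enum.
  have [-> | /ne //] := eqVneq j l.
  have : v 0 l *: e l + \sum_(k | k != l) v 0 k *: e k = 0.
    by rewrite -[RHS]pv [in RHS]linear_row [RHS](bigD1 l).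
  move/eqP; rewrite addr_eq0 => /eqP vel.
  rewrite -[e l]scale1r -bv -scalerA vel; apply: (submoduleZ sgs).
  apply: (submoduleN sgs); apply: (submodule_sum sgs) => k /ne.
  exact: (submoduleZ sgs).
have /minL : generated_by L (size gs).
  apply/generated_byP; exists gs; split=> //; apply/seteqP; split=> // y _.
  have [x <-] := psurj y; rewrite linear_row.
  by apply: (submodule_sum sgs) => k _; apply: (submoduleZ sgs); exact: egs.
rewrite size_map -cardE leqNgt => /negP; apply.
have : (#|[pred j | j != l]| < #|'I_n|)%N.
  by apply: proper_card; apply/properP; split; [exact: subset_predT | by exists l; rewrite // inE eqxx].
by rewrite card_ord.
Qed.

(** The images of the unit vectors form a basis. *)
Lemma free_of_injective_cover L n (p : {linear 'rV[R]_n -> L}) :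
  (forall y, exists x, p x = y) -> (forall x, p x = 0 -> x = 0) -> free_module L.
Proof.
move=> psurj pinj; exists (range (fun l => p (delta_mx 0 l))); split.
  move=> s a us sB sum0 b0 b0s.
  have /choice[l lE] b : exists l, b \in s -> p (delta_mx 0 l) = b.
    have [bs | bs] := boolP (b \in s); last first.
      have [l _ _] : range (fun l => p (delta_mx 0 l)) b0 by exact: sB.
      by exists l.
    by have [l _ <-] := sB b bs; exists l.
  have := pinj (\sum_(b <- s) a b *: delta_mx 0 (l b)).
  rewrite linear_sum /= big_seq.
  under eq_bigr => b bs do rewrite linearZ /= (lE b bs).
  rewrite -big_seq => /(_ sum0) /rowP /(_ (l b0)).
  rewrite summxE mxE (bigD1_seq b0) //= !mxE !eqxx mulr1 big_seq_cond big1 ?addr0 //.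
  move=> b /andP[bs bb0]; rewrite !mxE /=; case: eqP => [ll | _]; last by rewrite mulr0.
  by case/eqP: bb0; rewrite -(lE b bs) -ll lE.
move=> y; have [x <-] := psurj y.
have delta_inj l l' : p (delta_mx 0 l) = p (delta_mx 0 l') -> l = l'.
  move=> pl; have := pinj (delta_mx 0 l - delta_mx 0 l').
  rewrite linearB /= pl subrr => /(_ erefl) /rowP /(_ l).
  rewrite !mxE !eqxx /=; case: eqP => // _ /eqP.
  by rewrite subr0 oner_eq0.
exists [seq p (delta_mx 0 l) | l <- enum 'I_n],
  (fun b => \sum_(l | p (delta_mx 0 l) == b) x 0 l); split.
  by move=> b /= /mapP[l _ ->]; exists l.
rewrite linear_row big_map big_enum /=; apply: eq_bigr => l _.
rewrite (big_pred1 l) // => l'; apply/eqP/eqP => [/delta_inj //|-> //].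
Qed.

Lemma row_projective n : projective 'rV[R]_n.
Proof.
move=> A B q g qsurj.
have [|h [hE _]] := free_lift (submoduleT A) (q := q) (g := g); last by exists h.
by move=> v; have [a qa] := qsurj (g v); exists a.
Qed.

Lemma pd_finite_zero X : (forall x : X, x = 0) -> pd_finite X.
Proof.
move=> X0; exists 0%N, (fun=> 'rV[R]_0).
have [z zE] := zero_linear 'rV[R]_0 'rV[R]_0; have [e eE] := zero_linear 'rV[R]_0 X.
exists (fun=> z), e; split=> [i | i x _ | y | x | i x].
- exact: row_projective.
- exact: thinmx0.
- by exists 0; rewrite linear0 [y]X0.
- by rewrite eE; split=> // _; exists 0; rewrite zE [x]thinmx0.
- by rewrite zE; split=> // _; exists 0; rewrite zE [x]thinmx0.
Qed.

Lemma id_finite_zero X : (forall x : X, x = 0) -> id_finite X.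
Proof.
move=> X0; exists 0%N, (fun=> X).
have [z zE] := zero_linear X X.
exists (fun=> z), z; split=> [i | i x _ | x y _ | x | i x].
- move=> A B j g _; have [h hE] := zero_linear B X; exists h => a.
  by rewrite hE [RHS]X0.
- exact: X0.
- by rewrite [x]X0 [y]X0.
- by rewrite zE; split=> // _; exists 0; rewrite zE [x]X0.
- by rewrite zE; split=> // _; exists 0; rewrite zE [x]X0.
Qed.

Lemma tensor_zero_right M N : (forall y : N, y = 0) -> forall u : tensor M N, u = 0.
Proof.
move=> N0 u; have [s ->] := tensor_sum_tens u.
by apply: big1 => p _; rewrite (N0 p.2) linear0r.
Qed.

(** The data shared by both implications: a presentation of [M] as a minimal
    syzygy, a sequence [s] regular on [R] and [L] such that [R / (s)] has
    dimension zero, a socle element [c] of [R / (s)], a module [W]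
    injective over [R / (s)] with [c *: w] nonzero, and residue functionals of
    [M] and [N]. *)
Variables (M N L W : lmodType R) (s : seq R) (c : R) (w : W).
Variables (n : nat) (p : {linear 'rV[R]_n -> L}) (i : {linear M -> 'rV[R]_n}).
Hypotheses (ip : short_exact i p) (i_min : forall x l, m (i x 0 l))
  (s_m : [set` s] `<=` m) (s_R : regular_seq_mod [set 0 : R^o] s)
  (s_L : regular_seq_mod [set 0 : L] s)
  (s_socle : forall (V : lmodType R) (U : set V), submodule U -> U <> setT ->
     s ** V `<=` U -> has_socle m U)
  (c_nonzero : ~ (s ** R^o) c) (c_socle : forall r, m r -> (s ** R^o) (r * c))
  (W_inj : seq_injective s W) (cw : c *: w <> 0)
  (f : M -> R) (g : N -> R)
  (f_res : residue_functional m f) (g_res : residue_functional m g).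

Lemma socle_killed (w' : W) r : m r -> r *: (c *: w') = 0.
Proof.
move=> mr; have [h hE] := scale_linear w'; rewrite scalerA -hE.
apply: smul_killed (c_socle mr) => b x bs; rewrite hE scalerA mulrC -scalerA.
by rewrite (W_inj.1 b) // scaler0.
Qed.

(** Since [M] lies in [m] times the free module. *)
Lemma syzygy_killed (A : lmodType R) (h : {linear 'rV[R]_n -> A}) x :
  (forall r y, m r -> r *: h y = 0) -> h (i x) = 0.
Proof. by move=> mh; rewrite linear_row; apply: big1 => l _; exact: mh. Qed.

Lemma tensor_residue_contra h :
  residue_functional m h -> ~ forall x y, m (h (tens x y : tensor M N)).
Proof.
move=> hres mh; have [_ [u mhu]] := hres; apply: mhu.
have [us ->] := tensor_sum_tens u.
by apply: (submodule_sum (residue_functional_submodule R_local hres)) => v _; exact: mh.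
Qed.

Lemma socle_eq0 r : r *: (c *: w) = 0 -> m r.
Proof.
move=> rcw; apply: contrapT => /(local_unit R_noeth R_local)[b br].
by apply: cw; rewrite -[c *: w]scale1r -br -scalerA rcw scaler0.
Qed.

Lemma tensor_left_linear (y : N) :
  exists t : {linear M -> tensor M N}, forall x, t x = tens x y.
Proof. by apply: linear_map => a x x'; rewrite linearPl. Qed.

(** For [y] in [N] and [w] in [W], the map [x |-> (x (x) y) (x) w] extends to the
    free module, so the pairing [b], which is killed by [m], vanishes on its
    values; its value there is [h (x (x) y)] times the socle element [c w]. *)
Lemma tensor_pd_infinite : ~ pd_finite (tensor M N).
Proof.
move=> [k /projective_resolution_pd_le[k' pdk]].
have [h hres] := residue_functional_tensor R_noeth R_local f_res g_res
  (fun r mr => socle_killed w mr) cw.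
apply: (tensor_residue_contra hres) => x y; apply: socle_eq0.
have [b bE] : exists b : {bilinear tensor M N -> W -> W},
    forall u v, b u v = h u *: (c *: v).
  apply: bilinear_map => [v | u a v v'].
    have [H HE] := residue_scale hres (fun r mr => socle_killed v mr).
    by move=> a u u'; rewrite -!HE linearP.
  rewrite !scalerDr !scalerA; congr (_ *: _ + _).
  by rewrite !mulrA [LHS]mulrC mulrA.
have [beta betaE] := tensor_lift b.
have [t tE] := tensor_left_linear y.
have [H HE] := pd_le_tensor_extend R_noeth s_R w W_inj pdk t ip s_L.
have [F FE] : exists F : {linear 'rV[R]_n -> W}, forall v, F v = beta (H v).
  by apply: linear_map => a u v; rewrite !linearP.
have : F (i x) = 0.
  apply: syzygy_killed => r v mr; rewrite FE.
  have [us ->] := tensor_sum_tens (H v).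
  rewrite linear_sum scaler_sumr; apply: big1 => q _.
  by rewrite betaE bE scalerA mulrC -scalerA socle_killed // scaler0.
by rewrite FE HE tE betaE bE.
Qed.

(** The map [x |-> x (x) y] extends to the free module up to an error in [m X],
    and [th] vanishes both on the error and on the extension restricted to
    [M]. *)
Lemma tensor_id_infinite : ~ id_finite (tensor M N).
Proof.
move=> [k [E [d [e [E_inj E_bd einj ker_d0 ker_d]]]]].
have [h hres] := residue_functional_tensor R_noeth R_local f_res g_res
  (fun r mr => socle_killed w mr) cw.
apply: (tensor_residue_contra hres) => x y; apply: socle_eq0.
have [th thE] := residue_scale hres (fun r mr => socle_killed w mr).
have [t tE] := tensor_left_linear y.
have [et etE] : exists et : {linear M -> E 0%N}, forall x, et x = e (t x).
  by apply: linear_map => a u v; rewrite !linearP.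
have [sM iM] := regular_seq_kernel ip (regular_seq_row n s_R) s_L.
have [|H [Hcyc Het]] := @extend_modulo R m s c R_noeth R_local E d k E_inj E_bd ker_d
   s_R s_socle c_nonzero c_socle [::] s 0 M n i et erefl erefl s_m sM iM.
  move=> u; split=> //; rewrite etE; apply/ker_d0; by exists (t u).
have /choice[H0 H0E] v : exists u, e u = H v by apply/ker_d0; case: (Hcyc v).
have [F FE] : exists F : {linear 'rV[R]_n -> W}, forall v, F v = th (H0 v).
  apply: linear_map => a u v; rewrite -linearP; congr (th _); apply: einj.
  by rewrite linearP !H0E linearP.
have Fi : F (i x) = 0.
  by apply: syzygy_killed => r v mr; rewrite FE thE scalerA mulrC -scalerA socle_killed // scaler0.
pose Q : set (E 0%N) := [set q | exists u, e u = q /\ th u = 0].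
have [||u [uE thu]] := Het x Q.
- split; first by exists 0; rewrite !linear0.
  by move=> a _ _ [u [<- tu]] [v [<- tv]]; exists (a *: u + v);
    rewrite !linearP tu tv scaler0 addr0.
- move=> r q mr [dq _]; have [u <-] : exists u, e u = q by apply/ker_d0.
  exists (r *: u); rewrite !linearZ; split=> //.
  by rewrite /= thE scalerA mulrC -scalerA socle_killed // scaler0.
have {uE} uE : u = H0 (i x) - t x by apply: einj; rewrite uE linearB /= H0E etE.
by move: thu; rewrite uE linearB /= -FE Fi sub0r thE tE => /eqP; rewrite oppr_eq0 => /eqP.
Qed.

End SyzygyTensor.

Theorem corollary3p19 (R : comNzRingType) (m : set R)
    (R_noetherian : noetherian_ring R) (R_local : local_ring m)
    (R_CM : cohen_macaulay_ring m)
    (M N L : lmodType R)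
    (M_fg : fingen M) (N_fg : fingen N) (L_fg : fingen L)
    (L_MCM : maximal_cohen_macaulay m L) (L_nonfree : ~ free_module L)
    (M_syz : is_first_syzygy M L) :
  [<-> forall x : N, x = 0%R;
       pd_finite (tensor M N);
       id_finite (tensor M N)].
Proof.
have [d [[[s1 [s1d s1m s1reg]] _] dimd]] := R_CM.
have [d' [[[s2 [s2d s2m s2reg]] _] dimd']] := L_MCM.
have dd' := krull_dim_unique dimd dimd'.
have [s [sd sm sR sL]] := common_regular_seq R_noetherian R_local
  (fingen_regular R) L_fg (submodule0 _) (submodule0 _)
  (etrans s1d (etrans dd' (esym s2d))) s1m s2m (regular_seqW s1reg) (regular_seqW s2reg).
have s_socle (V : lmodType R) (U : set V) : submodule U -> U <> setT ->
    s ** V `<=` U -> has_socle m U.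
  move=> sU UT sVU; apply: (parameters_has_socle R_noetherian R_local (s := s)) => //.
    by rewrite sd s1d.
  move=> a v sa; have [h hE] := scale_linear v; rewrite -hE; apply: sVU.
  exact: smul_map.
have [c [sc mc]] : has_socle m (s ** R^o).
  apply: s_socle => //; first exact: smul_submodule.
  move=> sT; apply: (maximal_ideal_proper R_local).
  have : (s ** R^o) 1 by rewrite sT.
  apply: (smul_sub (maximal_ideal_submodule R_local)) => a v a_s.
  by rewrite /GRing.scale /= mulrC; apply: maximal_idealMl R_local _ _ (sm _ a_s).
have [W [w [Winj cw]]] := exists_seq_injective sc.
have [n [p [i [Lmu psurj iinj ker_p]]]] := M_syz.
have imin x l : m (i x 0 l).
  by apply: (minimal_cover_kernel R_noetherian R_local l Lmu psurj); apply/ker_p; exists x.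
have [x0 x0n0] : exists x : M, x <> 0.
  apply: contrapT => M0; apply: L_nonfree; apply: (free_of_injective_cover psurj).
  move=> v /ker_p[z <-]; have -> : z = 0 by apply: contrapT => zn0; apply: M0; exists z.
  by rewrite linear0.
have [f fres] := exists_residue_functional R_noetherian R_local M_fg (ex_intro _ x0 x0n0).
have N0 : (forall g, ~ @residue_functional R m N g) -> forall x : N, x = 0.
  move=> nog x; apply: contrapT => xn0.
  have [g gres] := exists_residue_functional R_noetherian R_local N_fg (ex_intro _ x xn0).
  exact: nog gres.
split; [|split].
- by move=> /(tensor_zero_right (M := M)); exact: pd_finite_zero.
- move=> pdX; apply: id_finite_zero; apply: tensor_zero_right; apply: N0 => g gres.
  exact: (tensor_pd_infinite R_noetherian R_local (And3 psurj iinj ker_p) imin sR sL mc Winj cw fres gres).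
- move=> idX; apply: N0 => g gres.
  exact: (tensor_id_infinite R_noetherian R_local (And3 psurj iinj ker_p) imin sm sR sL s_socle sc mc Winj cw fres gres).
Qed.
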